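(* In sponsored search with bidder and slot conflicts, with $n$ bidders, $m$ slots, and a bidder conflict graph of maximum out-degree $\Delta$, there is a universally truthful mechanism that yields an $\mathcal{O}(\log m)$-approximation of social welfare and runs in time $\mathcal{O}(n+(m(\Delta+1))^m)$.
   Context: Sponsored search with bidder and slot conflicts: a set $B$ of $n$ bidders and a set $I$ of $m$ slots; slot $k$ has a click-through rate $\alpha_k\ge 0$, bidder $i$ has a private value per click $v_i\ge 0$, and $v_i(S_i)=\max_{k\in S_i}v_i\alpha_k$ for $S_i\subseteq I$ (with $v_i(\emptyset)=0$). There are public directed graphs $G=(B,E)$ (bidder conflicts) and $G_I=(I,E_I)$ (slot conflicts); $\Delta$ is the maximum out-degree of $G$. An allocation is a tuple $S=(S_i)_{i\in B}$ of pairwise disjoint subsets of $I$. For an allocation $S$ let $D_i=\{k\in S_i\mid\exists j\in B,\ \exists\ell\in S_j:\ (i,j)\in E\text{ and }(k,\ell)\in E_I\}$ and $v_i^c(S)=v_i(S_i\setminus D_i)$. Social welfare is $\sum_{i\in B}v_i^c(S)$; a bidder's utility is $v_i^c(S)$ minus the payment. A randomized mechanism is universally truthful if for each realization of its random choices truthful reporting is a dominant strategy for every bidder. A randomized mechanism yields a $\rho$-approximation if (under truthful reports) its expected social welfare is at least $1/\rho$ times the maximum social welfare over all allocations. $\mathcal{O}(\log m)$ hides an absolute constant and is understood for large $m$. *)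

(* Defs.v *)
From mathcomp Require Import all_boot all_order all_algebra.
From mathcomp Require Import reals exp.

Set Implicit Arguments.
Unset Strict Implicit.
Unset Printing Implicit Defensive.

Import Order.TTheory GRing.Theory Num.Theory.
Local Open Scope ring_scope.

(* The public data. Bidders are 'I_n, slots are 'I_m. Both conflict relations
   are arbitrary directed graphs (self-loops are not excluded). *)
Record market (R : realType) (n m : nat) := Market {
  ctr : 'I_m -> R;
  ctr_ge0 : forall k, 0 <= ctr k;
  conflict : rel 'I_n;
  slot_conflict : rel 'I_m
}.

Definition outdeg (R : realType) n m (M : market R n m) (i : 'I_n) : nat :=
  #|[set j | conflict M i j]|.

Definition max_outdeg (R : realType) n m (M : market R n m) : nat :=
  \max_(i < n) outdeg M i.

(* Values per click, and likewise reports: one nonnegative real per bidder. *)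
Definition nonneg_profile (R : realType) n (v : 'I_n -> R) : Prop :=
  forall i, 0 <= v i.

Definition bundles (n m : nat) := {ffun 'I_n -> {set 'I_m}}.

Definition is_allocation n m (S : bundles n m) : bool :=
  [forall i, forall j, (i != j) ==> [disjoint S i & S j]].

(* Default 0 of the maximum: v(set0) = 0; otherwise harmless, as all the terms
   are nonnegative for 0 <= x. *)
Definition bundle_value (R : realType) n m (M : market R n m) (x : R)
    (X : {set 'I_m}) : R :=
  \big[Num.max/0]_(k in X) (x * ctr M k).

Definition conflicted (R : realType) n m (M : market R n m) (S : bundles n m)
    (i : 'I_n) : {set 'I_m} :=
  [set k in S i | [exists j, exists l,
     [&& l \in S j, conflict M i j & slot_conflict M k l]]].

(* v_i^c(S), as a function of the value per click x = v_i. *)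
Definition conflict_value (R : realType) n m (M : market R n m) (x : R)
    (S : bundles n m) (i : 'I_n) : R :=
  bundle_value M x (S i :\: conflicted M S i).

Definition social_welfare (R : realType) n m (M : market R n m)
    (v : 'I_n -> R) (S : bundles n m) : R :=
  \sum_(i < n) conflict_value M (v i) S i.

Definition opt_welfare (R : realType) n m (M : market R n m)
    (v : 'I_n -> R) : R :=
  \big[Num.max/0]_(S : bundles n m | is_allocation S) social_welfare M v S.

Definition outcome (R : realType) (n m : nat) : Type :=
  (bundles n m * ('I_n -> R))%type.

Definition det_mechanism (R : realType) (n m : nat) : Type :=
  ('I_n -> R) -> outcome R n m.

(* A randomized mechanism is a family of deterministic ones, indexed by the
   realization of an infinite sequence of independent fair coins. *)
Definition rand_mechanism (R : realType) (n m : nat) : Type :=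
  (nat -> bool) -> det_mechanism R n m.

Definition utility (R : realType) n m (M : market R n m) (x : R) (i : 'I_n)
    (o : outcome R n m) : R :=
  conflict_value M x o.1 i - o.2 i.

Definition truthful (R : realType) n m (M : market R n m)
    (f : det_mechanism R n m) : Prop :=
  forall (b : 'I_n -> R) (i : 'I_n) (x : R), nonneg_profile b -> 0 <= x ->
    utility M x i (f b) <= utility M x i (f [eta b with i |-> x]).

Definition universally_truthful (R : realType) n m (M : market R n m)
    (F : rand_mechanism R n m) : Prop :=
  forall w : nat -> bool, truthful M (F w).

(* Expectation of a quantity that depends on the first T coins only. *)
Definition expect (R : realType) (T : nat) (X : (nat -> bool) -> R) : R :=
  (\sum_(w : T.-tuple bool) X (nth false w)) / 2 ^+ T.

(* F is assumed to use at most T coins. *)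
Definition approximates (R : realType) n m (M : market R n m) (T : nat)
    (F : rand_mechanism R n m) (rho : R) : Prop :=
  0 < rho /\
  forall v : 'I_n -> R, nonneg_profile v ->
    opt_welfare M v / rho <= expect T (fun w => social_welfare M v (F w v).1).

(* A uniform real RAM with fair coins, programmed in a WHILE language. There
   are two zero-initialized unbounded memories, of naturals and of reals, with
   indirect addressing. As customary, unit-cost arithmetic is limited to
   addition and subtraction on naturals, and to the field operations and
   comparisons on reals; reals cannot be rounded or used as addresses, and
   programs contain no real constants besides naturals.

   The input is available by random access: n, m, the reports, the
   click-through rates, the adjacency matrices, and the out-degrees of the
   bidder conflict graph. Evaluating the expressions in one command costs one
   unit: a program is a fixed finite object, so that the size of its
   expressions is an absolute constant. *)
Inductive nexp : Type :=
| NConst of nat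
| NBidders
| NSlots
| NOutdeg of nexp
| NMem of nexp
| NAdd of nexp & nexp
| NSub of nexp & nexp.

Inductive rexp : Type :=
| RConst of nat
| RReport of nexp
| RCtr of nexp
| RMem of nexp
| RAdd of rexp & rexp
| RSub of rexp & rexp
| RMul of rexp & rexp
| RDiv of rexp & rexp.

Inductive bexp : Type :=
| BLeN of nexp & nexp
| BLeR of rexp & rexp
| BConflict of nexp & nexp
| BSlotConflict of nexp & nexp
| BNot of bexp
| BAnd of bexp & bexp.

(* CFlip a stores a fresh coin in the natural memory; CGive k i makes bidder i
   the owner of slot k; CCharge i x sets the payment of bidder i. *)
Inductive cmd : Type :=
| CSkip
| CSetN of nexp & nexp
| CSetR of nexp & rexp
| CFlip of nexp
| CGive of nexp & nexp
| CCharge of nexp & rexp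
| CSeq of cmd & cmd
| CIf of bexp & cmd & cmd
| CWhile of bexp & cmd.

Record state (R : realType) := State {
  nmem : nat -> nat;
  rmem : nat -> R;
  coins : nat;  (* number of coins used so far *)
  owner : nat -> option nat;
  payment : nat -> R
}.

Definition init_state (R : realType) : state R :=
  State (fun=> 0%N) (fun=> 0) 0 (fun=> None) (fun=> 0).

(* Input accesses out of range return a default. *)
Definition lookup (A : Type) (d : A) n (f : 'I_n -> A) (i : nat) : A :=
  oapp f d (insub i).

Definition lookup2 n (e : rel 'I_n) (i j : nat) : bool :=
  lookup false (fun i' => lookup false (e i') j) i.

Fixpoint neval (R : realType) n m (M : market R n m) (s : state R)
    (e : nexp) : nat :=
  match e with
  | NConst c => c
  | NBidders => n
  | NSlots => m
  | NOutdeg e => lookup 0%N (outdeg M) (neval M s e)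
  | NMem e => nmem s (neval M s e)
  | NAdd e1 e2 => (neval M s e1 + neval M s e2)%N
  | NSub e1 e2 => (neval M s e1 - neval M s e2)%N
  end.

Fixpoint reval (R : realType) n m (M : market R n m) (b : 'I_n -> R)
    (s : state R) (e : rexp) : R :=
  match e with
  | RConst c => c%:R
  | RReport e => lookup 0 b (neval M s e)
  | RCtr e => lookup 0 (ctr M) (neval M s e)
  | RMem e => rmem s (neval M s e)
  | RAdd e1 e2 => reval M b s e1 + reval M b s e2
  | RSub e1 e2 => reval M b s e1 - reval M b s e2
  | RMul e1 e2 => reval M b s e1 * reval M b s e2
  | RDiv e1 e2 => reval M b s e1 / reval M b s e2
  end.

Fixpoint beval (R : realType) n m (M : market R n m) (b : 'I_n -> R)
    (s : state R) (e : bexp) : bool :=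
  match e with
  | BLeN e1 e2 => (neval M s e1 <= neval M s e2)%N
  | BLeR e1 e2 => reval M b s e1 <= reval M b s e2
  | BConflict e1 e2 => lookup2 (conflict M) (neval M s e1) (neval M s e2)
  | BSlotConflict e1 e2 =>
      lookup2 (slot_conflict M) (neval M s e1) (neval M s e2)
  | BNot e => ~~ beval M b s e
  | BAnd e1 e2 => beval M b s e1 && beval M b s e2
  end.

(* A configuration is the stack of commands still to be executed, with the
   current state; it is halted when the stack is empty, and is then a fixed
   point of step. *)
Definition config (R : realType) : Type := (seq cmd * state R)%type.

Definition step (R : realType) n m (M : market R n m) (b : 'I_n -> R)
    (w : nat -> bool) (cf : config R) : config R :=
  let: (stack, s) := cf in
  if stack is c :: k then
    match c with
    | CSkip => (k, s)
    | CSetN a e =>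
        (k, State [eta nmem s with neval M s a |-> neval M s e]
              (rmem s) (coins s) (owner s) (payment s))
    | CSetR a e =>
        (k, State (nmem s) [eta rmem s with neval M s a |-> reval M b s e]
              (coins s) (owner s) (payment s))
    | CFlip a =>
        (k, State [eta nmem s with neval M s a |-> w (coins s) : nat]
              (rmem s) (coins s).+1 (owner s) (payment s))
    | CGive a e =>
        (k, State (nmem s) (rmem s) (coins s)
              [eta owner s with neval M s a |-> Some (neval M s e)]
              (payment s))
    | CCharge a e =>
        (k, State (nmem s) (rmem s) (coins s) (owner s)
              [eta payment s with neval M s a |-> reval M b s e])
    | CSeq c1 c2 => (c1 :: c2 :: k, s)
    | CIf t c1 c2 => ((if beval M b s t then c1 else c2) :: k, s)
    | CWhile t c1 => (if beval M b s t then c1 :: c :: k else k, s)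
    end
  else cf.

Definition run (R : realType) n m (M : market R n m) (P : cmd)
    (b : 'I_n -> R) (w : nat -> bool) (T : nat) : config R :=
  iter T (step M b w) ([:: P], init_state R).

(* Worst case over the reports and the coins. *)
Definition runs_in_time (R : realType) n m (M : market R n m) (P : cmd)
    (T : nat) : Prop :=
  forall (b : 'I_n -> R) (w : nat -> bool), nonneg_profile b ->
    (run M P b w T).1 = [::].

Definition output (R : realType) n m (s : state R) : outcome R n m :=
  ([ffun i : 'I_n => [set k : 'I_m | owner s k == Some (i : nat)]],
   fun i : 'I_n => payment s i).

(* The mechanism computed by P, for a P that runs in time T; it uses at most T
   coins, and any larger T gives the same outcome. *)
Definition computed_mechanism (R : realType) n m (M : market R n m) (P : cmd)
    (T : nat) : rand_mechanism R n m :=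
  fun w b => output n m (run M P b w T).2.

Lemma output_is_allocation (R : realType) n m (s : state R) :
  is_allocation (output n m s).1.
Proof.
apply/forallP => i; apply/forallP => j; apply/implyP => neq_ij.
rewrite !ffunE -setI_eq0 -subset0; apply/subsetP => k; rewrite !inE.
by case/andP=> /eqP-> /eqP[/val_inj eq_ij]; rewrite eq_ij eqxx in neq_ij.
Qed.

(* Main.v *)
Require Import Defs.
From mathcomp Require Import all_boot all_order all_algebra.
From mathcomp Require Import reals exp.
From mathcomp Require Import zify ring lra.

(* Each bidder is put in a sample with probability 1/2; sampled bidders win
   nothing. With V the highest sampled report, a price p = V / 2^t per click is
   posted, where t is uniform in [0, 2^q) and 2^q = O(log m). The unsampled
   bidders who report more than p are eligible, and are then treated alike: the
   mechanism maximizes the total click-through rate of a conflict-free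
   assignment of at most one slot per eligible bidder, and winners pay p per
   click. As a report matters only through eligibility, this is truthful.

   To stay within the time bound, only a random half of the slots is used, and
   an exhaustive search is run on the first h (2 Delta + 1) eligible bidders,
   where h is the number of slots used. No rate is lost: among that many bidders,
   h have no conflicts with each other. Self-loops would break the latter claim;
   a coin therefore admits either only the bidders with a self-loop, for whom a
   slot with a self-loop is worthless, or only those without.

   For the approximation, let bidder 1 have the highest value V among those
   admitted. The bidders with V / 2^t < v_i <= V / 2^(t-1) are served at a price
   of at least v_i / 2 when bidder 1 is sampled, they are not, and t is drawn.
   At most m bidders are left out, of value at most 2 V / 2^(2^q) <= 2 V / m.
   They and bidder 1 are paid for by the event that bidder 1 is not sampled, the
   second highest bidder is, and t = 0 (t = 1 if these two have equal values). *)

Set Implicit Arguments.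
Unset Strict Implicit.
Unset Printing Implicit Defensive.

Import Order.TTheory GRing.Theory Num.Theory.
Local Open Scope ring_scope.

(** * Execution of programs *)

Section Execution.
Variables (R : realType) (n m : nat) (M : market R n m).
Variables (b : 'I_n -> R) (w : nat -> bool).
Implicit Types (s : state R) (c : cmd) (Q : state R -> Prop).

(** Total correctness with a time bound. The step count and the final state are chosen before the
    continuation [k], so that runs of consecutive commands can be glued together. *)
Definition wp c (t : nat) Q s : Prop :=
  exists t' s', [/\ (t' <= t)%N, Q s' &
    forall k, iter t' (step M b w) (c :: k, s) = (k, s')].

Lemma wp_le c t1 t2 Q s : (t1 <= t2)%N -> wp c t1 Q s -> wp c t2 Q s.
Proof.
by move=> t12 [t [s' [le_t Qs' run_t]]]; exists t, s'; split=> //; lia.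
Qed.

Lemma wp_imp c t Q1 Q2 s : (forall s, Q1 s -> Q2 s) -> wp c t Q1 s -> wp c t Q2 s.
Proof. by move=> Q12 [t' [s' [? /Q12 ? ?]]]; exists t', s'. Qed.

Lemma wp_seq c1 c2 t1 t2 Q s :
  wp c1 t1 (wp c2 t2 Q) s -> wp (CSeq c1 c2) (t1 + t2).+1 Q s.
Proof.
move=> [t1' [s1 [le1 [t2' [s2 [le2 Qs2 run2]]] run1]]].
exists (t1' + t2').+1, s2; split=> // [|k]; first by lia.
by rewrite iterSr /= addnC iterD run1 run2.
Qed.

Lemma wp_if e c1 c2 t Q s :
  (beval M b s e -> wp c1 t Q s) -> (~~ beval M b s e -> wp c2 t Q s) ->
  wp (CIf e c1 c2) t.+1 Q s.
Proof.
move=> wp1 wp2; have [t' [s' [le_t Qs' run_t]]] :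
    wp (if beval M b s e then c1 else c2) t Q s by case: ifP wp1 wp2 => _; auto.
by exists t'.+1, s'; split=> // k; rewrite iterSr /= run_t.
Qed.

(** The invariant is indexed by the number of iterations done, and [i < N] under a true test forces
    termination. An iteration costs one test plus [t]; the last unit is the failing test. *)
Lemma wp_while e c t (N : nat) (I : nat -> state R -> Prop) s :
  (forall i s, I i s -> beval M b s e -> (i < N)%N /\ wp c t (I i.+1) s) ->
  I 0%N s ->
  wp (CWhile e c) (N * t.+1).+1
     (fun s => exists i, [/\ (i <= N)%N, I i s & ~~ beval M b s e]) s.
Proof.
move=> body I0.
suff H d i s0 : (i + d = N)%N -> I i s0 -> wp (CWhile e c) (d * t.+1).+1
     (fun s => exists i, [/\ (i <= N)%N, I i s & ~~ beval M b s e]) s0.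
  exact: (H N 0%N).
elim: d i s0 => [|d IH] i s0 def_N Ii.
  exists 1%N, s0; have [e_s0|e_s0] := boolP (beval M b s0 e).
    by have [] := body _ _ Ii e_s0; lia.
  by split=> // [|k]; [exists i; split=> //; lia | rewrite /= (negPf e_s0)].
have [e_s0|e_s0] := boolP (beval M b s0 e); last first.
  exists 1%N, s0; split=> // [|k]; last by rewrite /= (negPf e_s0).
  by exists i; split=> //; lia.
have [_ [t1 [s1 [le1 Is1 run1]]]] := body _ _ Ii e_s0.
have [||t2 [s2 [le2 Qs2 run2]]] := IH i.+1 s1 => //; first by lia.
exists (t1 + t2).+1, s2; split=> // [|k]; first by lia.
by rewrite iterSr /= e_s0 addnC iterD run1 run2.
Qed.

Fixpoint loopfree c : bool :=
  match c with
  | CSeq c1 c2 => loopfree c1 && loopfree c2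
  | CIf _ c1 c2 => loopfree c1 && loopfree c2
  | CWhile _ _ => false
  | _ => true
  end.

Fixpoint cost c : nat :=
  match c with
  | CSeq c1 c2 => (cost c1 + cost c2).+1
  | CIf _ c1 c2 => (maxn (cost c1) (cost c2)).+1
  | _ => 1
  end.

(** Direct semantics of straight-line code, so that loop bodies are computed by rewriting instead of
    step by step. The value at [CWhile] is a dummy, excluded by [loopfree]. *)
Fixpoint denote c s : state R :=
  match c with
  | CSeq c1 c2 => denote c2 (denote c1 s)
  | CIf e c1 c2 => if beval M b s e then denote c1 s else denote c2 s
  | CWhile _ _ => s
  | _ => (step M b w ([:: c], s)).2
  end.

Lemma wp_denote c Q s : loopfree c -> Q (denote c s) -> wp c (cost c) Q s.
Proof.
elim: c Q s => [|a e|a e|a|a e|a e|c1 IH1 c2 IH2|e c1 IH1 c2 IH2|e c IH] Q s //=;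
  try by move=> _ Qs; eexists 1%N, _; split; [|exact: Qs|].
- by move=> /andP[lf1 lf2] Qs; apply: wp_seq; apply: IH1 => //; apply: IH2.
- move=> /andP[lf1 lf2]; case: ifPn => e_s Qs; apply: wp_if => //.
  + by move=> _; apply: wp_le (IH1 _ _ lf1 Qs); rewrite leq_maxl.
  + by rewrite e_s.
  + by rewrite (negPf e_s).
  + by move=> _; apply: wp_le (IH2 _ _ lf2 Qs); rewrite leq_maxr.
Qed.

Lemma iter_step_halted t s : iter t (step M b w) ([::], s) = ([::], s).
Proof. by elim: t => //= t ->. Qed.

(** A halted configuration is a fixed point of [step], so any budget above the time bound gives the
    same final state. *)
Lemma wp_run c t T Q : wp c t Q (init_state R) -> (t <= T)%N ->
  (run M c b w T).1 = [::] /\ Q (run M c b w T).2.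
Proof.
move=> [t' [s [le_t Qs run_t]]] le_tT; rewrite /run.
have -> : T = (T - t' + t')%N by lia.
by rewrite iterD run_t iter_step_halted.
Qed.

Lemma lookup_ord (A : Type) (d : A) k (f : 'I_k -> A) (i : 'I_k) :
  lookup d f i = f i.
Proof. by rewrite /lookup valK. Qed.

Lemma lookup_default (A : Type) (d : A) k (f : 'I_k -> A) i :
  (k <= i)%N -> lookup d f i = d.
Proof. by move=> le_ki; rewrite /lookup insubN // -leqNgt. Qed.

End Execution.

(* Memory is split into 16 regions, cell i of region r having address
   16 * i + r; the scalar variables are the first cells of regions. *)
Definition addr (r i : nat) : nat := (16 * i + r)%N.

Arguments addr : simpl never.

Lemma eq_addr r r' i i' : (r < 16)%N -> (r' < 16)%N ->
  (addr r i == addr r' i') = (r == r') && (i == i').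
Proof. rewrite /addr; lia. Qed.

Lemma eq_addr0 r r' i : (r < 16)%N -> (r' < 16)%N ->
  (addr r i == r') = (r == r') && (i == 0%N).
Proof. rewrite /addr; lia. Qed.

Lemma eq_0addr r r' i : (r < 16)%N -> (r' < 16)%N ->
  (r == addr r' i) = (r == r') && (i == 0%N).
Proof. rewrite /addr; lia. Qed.

(** * Digits and independent sets *)

Local Close Scope ring_scope.

Section Digits.
Variable B : nat.
Hypothesis B_gt0 : (0 < B)%N.

Definition digit (x a : nat) : nat := (x %/ B ^ a) %% B.

Lemma ltn_digit x a : digit x a < B.
Proof. by rewrite ltn_mod. Qed.

Lemma digit0 a : digit 0 a = 0.
Proof. by rewrite /digit div0n mod0n. Qed.

Lemma digit_expn h a : a < h -> digit (B ^ h) a = 0.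
Proof.
move=> lt_ah; rewrite /digit -(subnK (ltnW lt_ah)) expnD mulnK ?expn_gt0 ?B_gt0 //.
by rewrite -(subnSK lt_ah) expnS mulnC modnMl.
Qed.

(** Every table of [h] digits is the code of a number below [B ^ h]; the induction adds the most
    significant digit. *)
Lemma digit_surj h (f : nat -> nat) : (forall a, a < h -> f a < B) ->
  exists2 x, x < B ^ h & forall a, a < h -> digit x a = f a.
Proof.
elim: h => [|h IH] lt_f; first by exists 0.
have [|x lt_x dig_x] := IH; first by move=> a lt_a; apply: lt_f; lia.
exists (f h * B ^ h + x).
  rewrite expnS; apply: (@leq_trans ((f h).+1 * B ^ h)); first by rewrite mulSn; lia.
  by rewrite leq_mul2r lt_f ?orbT.
move=> a; rewrite ltnS leq_eqVlt => /predU1P[->|lt_ah].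
  by rewrite /digit divnMDl ?expn_gt0 ?B_gt0 // divn_small // addn0 modn_small ?lt_f.
rewrite -(dig_x a) // /digit -(subnK (ltnW lt_ah)) expnD mulnA divnMDl ?expn_gt0 ?B_gt0 //.
by rewrite -(subnSK lt_ah) expnSr mulnA modnMDl.
Qed.

Lemma modn_max_digits x i : (forall a, a < i -> digit x a = B.-1) ->
  x %% B ^ i = (B ^ i).-1.
Proof.
elim: i => [|i IH] max_x; first by rewrite modn1.
have def_r : x %% B ^ i = (B ^ i).-1 by apply: IH => a lt_a; apply: max_x; lia.
have Bi_gt0 : 0 < B ^ i by rewrite expn_gt0 B_gt0.
have := max_x i (ltnSn i); rewrite /digit => def_d.
have def_x : x = (x %/ B ^ i %/ B * B + B.-1) * B ^ i + (B ^ i).-1.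
  by rewrite -[B.-1]def_d -[(B ^ i).-1]def_r -!divn_eq.
have -> : x = x %/ B ^ i %/ B * B ^ i.+1 + (B ^ i.+1).-1.
  rewrite [LHS]def_x expnS mulnDl mulnA -addnA; congr (_ + _).
  by case: (B) B_gt0 => // B' _ /=; rewrite mulSn; lia.
by rewrite modnMDl modn_small // ltn_predL expn_gt0 B_gt0.
Qed.

Lemma digitS_carry x i : (forall a, a < i -> digit x a = B.-1) ->
  x.+1 = (x %/ B ^ i).+1 * B ^ i.
Proof.
move/modn_max_digits => def_r; rewrite [in LHS](divn_eq x (B ^ i)) def_r mulSn.
by rewrite -addnS prednK ?expn_gt0 ?B_gt0 // addnC.
Qed.

(** The odometer step: [i] is the first position where the carry stops. This is the specification of
    [carry] followed by one increment. *)
Lemma digitS x i : (forall a, a < i -> digit x a = B.-1) -> digit x i < B.-1 ->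
  forall a, digit x.+1 a =
    if a < i then 0 else if a == i then (digit x i).+1 else digit x a.
Proof.
move=> max_x lt_i a; have def_x1 := digitS_carry max_x.
have Bi_gt0 j : 0 < B ^ j by rewrite expn_gt0 B_gt0.
case: ltngtP => [lt_ai|lt_ia|->].
- rewrite /digit def_x1 -(subnK (ltnW lt_ai)) expnD mulnA mulnK //.
  by rewrite -(subnSK lt_ai) expnSr mulnA modnMl.
- rewrite /digit -(subnKC lt_ia) expnD expnSr def_x1 !divnMA mulnK //.
  suff -> : (x %/ B ^ i).+1 %/ B = x %/ B ^ i %/ B by [].
  rewrite [x %/ B ^ i in LHS](divn_eq _ B) -addnS divnMDl // [_.+1 %/ B]divn_small ?addn0 //.
  by move: lt_i; rewrite /digit; lia.
- rewrite /digit def_x1 mulnK // -addn1 -modnDml addn1 modn_small //.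
  by move: lt_i; rewrite /digit; case: (B) => [|B1] /=; case: (_ %% _) => *; lia.
Qed.

Lemma digitS_overflow x h : x < B ^ h ->
  (forall a, a < h -> digit x a = B.-1) -> x.+1 = B ^ h.
Proof.
by move=> lt_x /digitS_carry ->; rewrite divn_small // mul1n.
Qed.

End Digits.

(** Merges the successive divisions by [2 ^ (2 ^ j)] made by the program into one division by
    [2 ^ t]. *)
Lemma bits_sum q t : t < 2 ^ q -> \sum_(j < q | digit 2 t j == 1) 2 ^ j = t.
Proof.
move=> lt_t; suff -> : \sum_(j < q | digit 2 t j == 1) 2 ^ j = t %% 2 ^ q.
  by rewrite modn_small.
elim: q {lt_t} => [|q IH]; first by rewrite big_ord0 modn1.
rewrite big_mkcond big_ord_recr -big_mkcond /= IH.
have -> : t %% 2 ^ q.+1 = (t %/ 2 ^ q) %% 2 * 2 ^ q + t %% 2 ^ q.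
  rewrite [in LHS](divn_eq t (2 ^ q)) [t %/ 2 ^ q in LHS](divn_eq _ 2).
  rewrite mulnDl -mulnA -expnS -addnA modnMDl modn_small //.
  have: t %% 2 ^ q < 2 ^ q by rewrite ltn_mod expn_gt0.
  have: (t %/ 2 ^ q) %% 2 < 2 by rewrite ltn_mod.
  by case: (_ %% 2) => [|[|//]] _; rewrite expnS; lia.
rewrite /digit addnC; congr (_ + _).
have: (t %/ 2 ^ q) %% 2 < 2 by rewrite ltn_mod.
by case: (_ %% 2) => [|[|]] //=; rewrite mul1n.
Qed.

Section IndependentSet.
Variables (T : finType) (e : rel T) (D : nat).

(* The in-degrees within W are at most D on average: pick a vertex with in-degree
   at most D, discard its neighbours, and iterate. *)
Lemma independent_subset (h : nat) (W : {set T}) :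
  (forall x, #|[set y | e x y]| <= D) -> h * D.*2.+1 <= #|W| ->
  exists J : {set T}, [/\ J \subset W, #|J| = h &
    {in J &, forall x y, x != y -> ~~ e x y}].
Proof.
move=> out_e; elim: h W => [|h IH] W le_hW.
  by exists set0; split; rewrite ?sub0set ?cards0 // => x y; rewrite inE.
have [x Wx in_x] : exists2 x, x \in W & #|[set y in W | e y x]| <= D.
  apply/exists_inP; apply: contraT; rewrite negb_exists_in => /forall_inP lt_in.
  have card_rel (P : pred T) (A : {set T}) : #|[set y in A | P y]| = \sum_(y in A) P y.
    by rewrite -sum1dep_card big_mkcondr.
  (* If all in-degrees within [W] exceeded [D], counting the arcs inside [W] by head and by tail
     would yield this absurd inequality. *)
  have : \sum_(x in W) D.+1 <= \sum_(y in W) D.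
    apply: leq_trans (_ : \sum_(x in W) #|[set y in W | e y x]| <= _).
      by apply: leq_sum => x Wx; rewrite ltnNge lt_in.
    under eq_bigr do rewrite card_rel.
    rewrite exchange_big leq_sum //= => y _; rewrite -card_rel.
    apply: leq_trans (out_e y); apply/subset_leq_card/subsetP => x.
    by rewrite !inE => /andP[].
  rewrite !sum_nat_const leq_pmul2l ?ltnn //; nia.
pose N := x |: ([set y | e x y] :|: [set y in W | e y x]).
have le_N : #|N| <= D.*2.+1.
  rewrite cardsU1 -addn1 addnC; apply: leq_add; last exact: leq_b1.
  rewrite -addnn; apply: leq_trans (leq_add (out_e x) in_x).
  by rewrite cardsU leq_subr.
have [|J [sJW cardJ indJ]] := IH (W :\: N).
  rewrite cardsD; have := subset_leq_card (subsetIr W N).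
  by move: le_hW; rewrite mulSn; lia.
have notin_J y : y \in J -> [&& x != y, ~~ e x y & ~~ e y x].
  move=> /(subsetP sJW); rewrite !inE => /andP[].
  by rewrite eq_sym !negb_or => /and3P[-> -> /nandP[/negP|->//]].
exists (x |: J); split.
- by rewrite subUset sub1set Wx (subset_trans sJW (subsetDl _ _)).
- rewrite cardsU1 cardJ; case: (boolP (x \in J)) => // /notin_J.
  by rewrite eqxx.
move=> y z /setU1P[->|Jy] /setU1P[->|Jz].
- by rewrite eqxx.
- by have /and3P[_ ->] := notin_J _ Jz.
- by have /and3P[_ _ ->] := notin_J _ Jy.
- exact: indJ.
Qed.

End IndependentSet.

Local Open Scope ring_scope.

(** * Exhaustive search *)

Section Search.
Variables (R : realType) (n m : nat) (M : market R n m).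
Variables (lst : seq nat) (off h : nat).

Let B := (size lst).+1.
Let rate (a : nat) : R := lookup 0 (ctr M) (off + a).

(* Bidder n, which does not exist, stands for nobody: digit 0 leaves the slot
   unassigned. *)
Definition holder (x a : nat) : nat := nth n (n :: lst) (digit B x a).

(** The first disjunct enforces one slot per bidder, the second forbids conflicts. The second
    includes [a = c], which is how self-loops are handled. *)
Definition clash (x a c : nat) : bool :=
  [&& a != c, digit B x a == digit B x c & digit B x a != 0%N]
  || lookup2 (conflict M) (holder x a) (holder x c)
     && lookup2 (slot_conflict M) (off + a) (off + c).

Definition clashing (x : nat) : bool :=
  has (fun a => has (clash x a) (iota 0 h)) (iota 0 h).

(** As rates are nonnegative, a score of 0 keeps a clashing code from ever beating the empty
    assignment, whose code is 0. *)
Definition score (x : nat) : R :=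
  if clashing x then 0 else \sum_(a < h | digit B x a != 0%N) rate a.

(** The first maximizer of the score among the codes below [x], by a recursion that mirrors the
    search loop. *)
Fixpoint best_code (x : nat) : nat :=
  if x is y.+1 then
    if score (best_code y) < score y then y else best_code y
  else 0%N.

Lemma rate_ge0 a : 0 <= rate a.
Proof.
rewrite /rate /lookup; case: insub => //= k; exact: ctr_ge0.
Qed.

Lemma score_ge0 x : 0 <= score x.
Proof. by rewrite /score; case: ifP => // _; apply: sumr_ge0 => *; apply: rate_ge0. Qed.

Lemma score_le_best x y : (x < y)%N -> score x <= score (best_code y).
Proof.
elim: y => // y IH; rewrite ltnS leq_eqVlt => /predU1P[->|/IH le_x] /=.
  by case: ltP => // /ltW.
by case: ltP => // /ltW; apply: le_trans.
Qed.

Lemma lookup2_default (T : nat) (e : rel 'I_T) i j :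
  (T <= i)%N || (T <= j)%N -> lookup2 e i j = false.
Proof.
case/orP=> [le_i|le_j]; first by rewrite /lookup2 lookup_default.
by rewrite /lookup2 {1}/lookup; case: insub => //= i'; rewrite lookup_default.
Qed.

Lemma lookup2_ord (T : nat) (e : rel 'I_T) (i j : 'I_T) : lookup2 e i j = e i j.
Proof. by rewrite /lookup2 !lookup_ord. Qed.

Lemma clashing0 : clashing 0 = false.
Proof.
apply/hasP => -[a _ /hasP[c _]]; rewrite /clash /holder !digit0 /= andbF /=.
by rewrite lookup2_default // leqnn.
Qed.

(** A code replaces the current one only with a positive score, which a clashing code does not have;
    the initial code 0 is clash-free. *)
Lemma clashing_best x : clashing (best_code x) = false.
Proof.
elim: x => [|x IH] /=; first exact: clashing0.
case: ltP => // lt_x; case: (boolP (clashing x)) => // cl_x; move: lt_x.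
by rewrite [in X in _ < X]/score cl_x ltNge score_ge0.
Qed.

(** Any feasible assignment, described by the holder of each slot of the block ([n] for nobody), is
    the decoding of some code that the search visits. *)
Lemma score_assignment (f : nat -> nat) :
  n \notin lst -> uniq lst ->
  (forall a, (a < h)%N -> f a \in n :: lst) ->
  (forall a c, (a < h)%N -> (c < h)%N -> f a = f c -> f a = n \/ a = c) ->
  (forall a c, (a < h)%N -> (c < h)%N ->
     ~~ (lookup2 (conflict M) (f a) (f c)
         && lookup2 (slot_conflict M) (off + a) (off + c))) ->
  \sum_(a < h | f a != n) rate a <= score (best_code (B ^ h)).
Proof.
move=> n_lst uniq_lst f_lst f_inj f_ok.
have f_B a : (a < h)%N -> (index (f a) (n :: lst) < B)%N.
  by move/f_lst; rewrite -index_mem.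
have [x lt_x dig_x] := digit_surj (ltn0Sn (size lst)) f_B.
have hold_x a : (a < h)%N -> holder x a = f a.
  by move=> lt_a; rewrite /holder dig_x // nth_index // f_lst.
have dig_x0 a : (a < h)%N -> (digit B x a == 0%N) = (f a == n).
  by move=> lt_a; rewrite dig_x //= [f a == n]eq_sym; case: (n == f a).
apply: le_trans (score_le_best lt_x); rewrite /score ifF.
  by rewrite le_eqVlt; apply/predU1P; left; apply: eq_bigl => a; rewrite dig_x0.
apply/hasP => -[a + /hasP[c]]; rewrite !mem_iota !add0n => /= lt_a lt_c.
rewrite /clash !hold_x // (negPf (f_ok _ _ _ _)) //.
rewrite orbF dig_x0 // => /and3P[neq_ac /eqP eq_d /negP[]]; apply/eqP.
have eq_f : f a = f c by rewrite -!hold_x // /holder eq_d.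
by case: (f_inj a c) => // eq_ac; rewrite eq_ac eqxx in neq_ac.
Qed.

End Search.

(** * Restricting the search to a short list of eligible bidders *)

Section SelectAndSearch.
Variables (R : realType) (n m : nat) (M : market R n m).
Variables (off h : nat) (elig : pred nat) (c : bool).
Hypothesis elig_type : forall i, elig i -> lookup2 (conflict M) i i = c.

Definition capacity : nat := h * (max_outdeg M).*2.+1.

Definition shortlist : seq nat := take capacity [seq i <- iota 0 n | elig i].

Lemma shortlist_uniq : uniq shortlist.
Proof. by rewrite take_uniq // filter_uniq // iota_uniq. Qed.

Lemma mem_shortlist i : i \in shortlist -> elig i && (i < n)%N.
Proof. by move/mem_take; rewrite mem_filter mem_iota add0n => /andP[->]. Qed.

Lemma notin_shortlist : n \notin shortlist.
Proof. by apply/negP => /mem_shortlist; rewrite ltnn andbF. Qed.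

Lemma outdeg_le_max (i : 'I_n) : (outdeg M i <= max_outdeg M)%N.
Proof. exact: (leq_bigmax i). Qed.

(** If the list holds all eligible bidders, the assignment of [W] itself is searched. Otherwise the
    list is full and contains [h] bidders without mutual conflicts, who can take over the slots used
    by [W]: only rates count, not who wins. *)
Lemma shortlist_optimal (W : {set 'I_n}) (slot : 'I_n -> 'I_m) :
  {in W, forall i : 'I_n, elig i} ->
  {in W &, injective slot} ->
  {in W, forall i, off <= slot i < off + h}%N ->
  {in W &, forall i j, ~~ (conflict M i j && slot_conflict M (slot i) (slot j))} ->
  \sum_(i in W) ctr M (slot i) <=
    score M shortlist off h (best_code M shortlist off h ((size shortlist).+1 ^ h)).
Proof.
move=> W_elig slot_inj slot_block W_ok.
pose used a := [exists i in W, slot i == (off + a)%N :> nat].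
have sum_used : \sum_(i in W) ctr M (slot i) <=
    \sum_(a < h | used a) lookup 0 (ctr M) (off + a).
  pose pos i := (slot i - off)%N.
  have pos_slot i : i \in W -> (off + pos i)%N = slot i.
    by move/slot_block => /andP[? _]; rewrite subnKC.
  have pos_lt i : i \in W -> (pos i < h)%N by move/slot_block; rewrite /pos; lia.
  rewrite (eq_bigr (fun i => \sum_(a < h | a == pos i :> nat) lookup 0 (ctr M) (off + a)));
    last first.
    move=> i Wi; rewrite (big_pred1 (Ordinal (pos_lt i Wi))) /=.
      by rewrite pos_slot // lookup_ord.
    by move=> a.
  rewrite (exchange_big_dep (fun a : 'I_h => used a)) /=; last first.
    by move=> i a Wi /eqP eq_a; apply/exists_inP; exists i; rewrite // eq_a pos_slot.
  apply: ler_sum => a /exists_inP[i Wi /eqP slot_i].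
  rewrite (big_pred1 i) // => j /=; apply/andP/eqP => [[Wj /eqP eq_a]|->].
    by apply: slot_inj => //; apply: val_inj; rewrite /= slot_i eq_a pos_slot.
  by split=> //; rewrite /pos slot_i addKn.
apply: le_trans sum_used _.
suff [f [f_used f_list f_inj f_ok]] : exists f : nat -> nat,
   [/\ forall a, (a < h)%N -> (f a != n) = used a,
       forall a, (a < h)%N -> f a \in n :: shortlist,
       forall a a', (a < h)%N -> (a' < h)%N -> f a = f a' -> f a = n \/ a = a' &
       forall a a', (a < h)%N -> (a' < h)%N ->
     ~~ (lookup2 (conflict M) (f a) (f a')
         && lookup2 (slot_conflict M) (off + a) (off + a'))].
  rewrite (eq_bigl (fun a : 'I_h => f a != n)) => [|a]; last by rewrite f_used.
  exact: score_assignment notin_shortlist shortlist_uniq f_list f_inj f_ok.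
have [small|large] := leqP (size [seq i <- iota 0 n | elig i]) capacity.
  pose f a := if [pick i in W | slot i == (off + a)%N :> nat] is Some i
              then i : nat else n.
  have fP a : (f a = n /\ used a = false) \/
      exists i : 'I_n, [/\ f a = i, used a, i \in W & slot i = (off + a)%N :> nat].
    rewrite /f; case: pickP => [i /andP[Wi /eqP slot_i]|no_i]; [right|left].
      exists i; split=> //; apply/exists_inP; exists i => //; exact/eqP.
    by split=> //; apply/existsP => -[i]; rewrite no_i.
  have lt_ord (i : 'I_n) : (i == n :> nat) = false by rewrite ltn_eqF.
  exists f; split=> [a _|a _|a a' _ _|a a' _ _].
  - by case: (fP a) => [[-> ->]|[i [-> -> _ _]]]; rewrite ?eqxx ?lt_ord.
  - case: (fP a) => [[-> _]|[i [-> _ Wi _]]]; rewrite inE ?eqxx // lt_ord /=.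
    by rewrite /shortlist take_oversize // mem_filter W_elig // mem_iota /=.
  - case: (fP a) => [[-> _]|[i [-> _ _ slot_i]]]; first by left.
    case: (fP a') => [[-> _]|[i' [-> _ _ slot_i']]] eq_i; first by left.
    by move: slot_i'; rewrite -(val_inj eq_i) slot_i; lia.
  - case: (fP a) => [[-> _]|[i [-> _ Wi slot_i]]].
      by rewrite lookup2_default ?leqnn.
    case: (fP a') => [[-> _]|[i' [-> _ Wi' slot_i']]].
      by rewrite lookup2_default ?leqnn ?orbT.
    by rewrite -slot_i -slot_i' !lookup2_ord W_ok.
have size_short : size shortlist = capacity by rewrite size_takel // ltnW.
have card_short : #|[set i : 'I_n | val i \in shortlist]| = capacity.
  rewrite -size_short cardE -(size_map val) /enum_mem.
  apply/perm_size/uniq_perm; [|exact: shortlist_uniq|].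
    by rewrite map_inj_uniq ?enum_uniq //; exact: val_inj.
  move=> i; apply/mapP/idP => [[j]|short_i]; first by rewrite mem_enum inE => ? ->.
  have /andP[_ lt_i] := mem_shortlist short_i.
  by exists (Ordinal lt_i); rewrite // mem_enum inE.
have [||J [sub_J card_J indep_J]] :=
  @independent_subset _ (conflict M) (max_outdeg M) h [set i : 'I_n | val i \in shortlist].
- exact: outdeg_le_max.
- by rewrite card_short.
(* Position [a] goes to the [a]-th independent bidder, but only if [W] uses that slot. *)
pose f a := if used a then nth n (map val (enum J)) a else n.
have size_J : size (map val (enum J)) = h by rewrite size_map -cardE.
have fP a : (a < h)%N -> (f a = n /\ used a = false) \/
    exists i : 'I_n, [/\ f a = i, used a, i \in J & nth n (map val (enum J)) a = i].
  move=> lt_a; rewrite /f; case: ifP => used_a; [right|by left].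
  have /mapP[i] : nth n (map val (enum J)) a \in map val (enum J).
    by rewrite mem_nth // size_J.
  by rewrite mem_enum => Ji eq_i; exists i.
have lt_ord (i : 'I_n) : (i == n :> nat) = false by rewrite ltn_eqF.
have uniq_J : uniq (map val (enum J)).
  by rewrite map_inj_uniq ?enum_uniq //; exact: val_inj.
have f_inj a a' : (a < h)%N -> (a' < h)%N -> f a = f a' -> f a = n \/ a = a'.
  move=> lt_a lt_a'; case: (fP a lt_a) => [[-> _]|[i [-> _ _ nth_i]]]; first by left.
  case: (fP a' lt_a') => [[-> _]|[i' [-> _ _ nth_i']]] eq_i; first by left.
  by right; apply/eqP; rewrite -(nth_uniq n _ _ uniq_J) ?size_J // nth_i nth_i' eq_i.
exists f; split=> [a lt_a|a lt_a|//|a a' lt_a lt_a'].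
- by case: (fP a lt_a) => [[-> ->]|[i [-> -> _ _]]]; rewrite ?eqxx ?lt_ord.
- case: (fP a lt_a) => [[-> _]|[i [-> _ Ji _]]]; rewrite inE ?eqxx // lt_ord /=.
  by have := subsetP sub_J _ Ji; rewrite inE.
(* Independence is silent about a bidder and itself. For a self-loop, the new holder has the same
   status [c] as the member [j] of [W] who held this slot, and [j] had no conflict there. *)
- have [eq_aa|neq_aa] := eqVneq a a'.
    rewrite -{}eq_aa; case: (fP a lt_a) => [[-> _]|[i [-> used_a Ji _]]].
      by rewrite lookup2_default ?leqnn.
    have /exists_inP[j Wj /eqP slot_j] := used_a.
    have := subsetP sub_J _ Ji; rewrite inE => /mem_shortlist/andP[elig_i _].
    rewrite elig_type // -(elig_type (W_elig j Wj)) -slot_j !lookup2_ord.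
    exact: W_ok.
  have := f_inj a a' lt_a lt_a'.
  case: (fP a lt_a) => [[-> _]|[i [-> _ Ji _]]].
    by rewrite lookup2_default ?leqnn.
  case: (fP a' lt_a') => [[-> _]|[i' [-> _ Ji' _]]].
    by rewrite lookup2_default ?leqnn ?orbT.
  move=> inj_i; rewrite lookup2_ord (negPf (indep_J _ _ Ji Ji' _)) //.
  apply/eqP => eq_i; have [|] := inj_i (congr1 val eq_i).
    by move/eqP; rewrite lt_ord.
  by move/eqP; rewrite (negPf neq_aa).
Qed.

End SelectAndSearch.

(** * The program *)

(** An expression for [addr r e]: four doublings, since naturals have no multiplication. *)
Definition cell (r : nat) (e : nexp) : nexp :=
  let e2 := NAdd e e in let e4 := NAdd e2 e2 in let e8 := NAdd e4 e4 in
  NAdd (NAdd e8 e8) (NConst r).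

(** * Frame conditions and loop rules *)

Section Frame.
Variables (R : realType) (n m : nat) (M : market R n m).
Variables (b : 'I_n -> R) (w : nat -> bool).
(* The regions and the real cells that may be written, and whether coins may be
   flipped and outputs produced. *)
Variables (rs qs : seq nat) (fl out : bool).

Lemma neval_cell (s : state R) r e : neval M s (cell r e) = addr r (neval M s e).
Proof. rewrite /cell /addr /=; lia. Qed.

Definition in_regions (a : nexp) : Prop :=
  exists2 r, (r < 16)%N && (r \in rs) & a = NConst r \/ exists e, a = cell r e.

Fixpoint writes_within (c : cmd) : Prop :=
  match c with
  | CSkip => True
  | CSetN a _ => in_regions a
  | CSetR a _ => exists2 q, q \in qs & a = NConst q
  | CFlip a => fl /\ in_regions a
  | CGive _ _ | CCharge _ _ => out
  | CSeq c1 c2 | CIf _ c1 c2 => writes_within c1 /\ writes_within c2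
  | CWhile _ c => writes_within c
  end.

Record frame (s s' : state R) : Prop := Frame {
  frame_cell : forall r i, (r < 16)%N -> r \notin rs ->
    nmem s' (addr r i) = nmem s (addr r i);
  frame_rmem : forall q, q \notin qs -> rmem s' q = rmem s q;
  frame_coins : ~~ fl -> coins s' = coins s;
  frame_owner : ~~ out -> owner s' = owner s;
  frame_payment : ~~ out -> payment s' = payment s
}.

Lemma frame_var (s s' : state R) r : frame s s' -> (r < 16)%N -> r \notin rs ->
  nmem s' r = nmem s r.
Proof. by move=> F lt_r /(frame_cell F 0 lt_r). Qed.

Lemma frame_refl s : frame s s. Proof. by []. Qed.

Lemma addr_out_regions s a r i : in_regions a -> (r < 16)%N -> r \notin rs ->
  (addr r i == neval M s a) = false.
Proof.
move=> [r' /andP[lt_r' in_r'] def_a] lt_r r_rs.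
have neq_r : (r == r') = false by apply: contraNF r_rs => /eqP->.
by case: def_a => [->|[e ->]]; rewrite ?neval_cell /= ?eq_addr ?eq_addr0 ?neq_r.
Qed.

Lemma step_frame stack s0 s :
  foldr (fun c => and (writes_within c)) True stack -> frame s0 s ->
  foldr (fun c => and (writes_within c)) True (step M b w (stack, s)).1 /\
  frame s0 (step M b w (stack, s)).2.
Proof.
case: stack => [|c k] //= [].
case: c => [|a e|a e|a|a e|a e|c1 c2|e c1 c2|e c] //=.
- move=> rs_a ? F; split=> //; split=> //=; try by case: F.
  by move=> r i lt_r r_rs; rewrite addr_out_regions // (frame_cell F).
- move=> [q qs_q ->] ? F; split=> //; split=> //=; try by case: F.
  move=> q'; case: eqP => [->|_]; [by rewrite qs_q | exact: frame_rmem F _].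
- move=> [fl_ok rs_a] ? F; split=> //; split=> //=; try by case: F.
    by move=> r i lt_r r_rs; rewrite addr_out_regions // (frame_cell F).
  by rewrite fl_ok.
- by move=> out_ok ? F; split=> //; split=> //=; try (by case: F); rewrite out_ok.
- by move=> out_ok ? F; split=> //; split=> //=; try (by case: F); rewrite out_ok.
- by move=> [].
- by move=> []; case: ifP.
- by case: ifP.
Qed.

(** The check on writes is syntactic and is inherited by every stack reached, so preservation of the
    other cells comes for free with any specification. *)
Lemma wp_frame c t Q s : writes_within c ->
  wp M b w c t Q s -> wp M b w c t (fun s' => frame s s' /\ Q s') s.
Proof.
move=> wr_c [t' [s' [le_t Qs' run_t]]]; exists t', s'; split=> //; split=> //.
have: foldr (fun c => and (writes_within c)) True (iter t' (step M b w) ([:: c], s)).1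
   /\ frame s (iter t' (step M b w) ([:: c], s)).2.
  elim: (t') => [|j [IH1 IH2]]; first by split; [| exact: frame_refl].
  by rewrite iterS; case: (iter _ _ _) IH1 IH2 => stack s1; apply: step_frame.
by case=> _; rewrite run_t.
Qed.

Lemma frame_trans s1 s2 s3 : frame s1 s2 -> frame s2 s3 -> frame s1 s3.
Proof.
move=> F1 F2; split=> [r i *|q *|?|?|?].
- by rewrite (frame_cell F2) // (frame_cell F1).
- by rewrite (frame_rmem F2) // (frame_rmem F1).
- by rewrite (frame_coins F2) // (frame_coins F1).
- by rewrite (frame_owner F2) // (frame_owner F1).
- by rewrite (frame_payment F2) // (frame_payment F1).
Qed.

Lemma wp_while_frame e c t (N : nat) (I : nat -> state R -> Prop) s :
  writes_within c ->
  (forall i s', frame s s' -> I i s' -> beval M b s' e ->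
     (i < N)%N /\ wp M b w c t (I i.+1) s') ->
  I 0%N s ->
  wp M b w (CWhile e c) (N * t.+1).+1 (fun s' => frame s s' /\
     exists i, [/\ (i <= N)%N, I i s' & ~~ beval M b s' e]) s.
Proof.
move=> wr_c body I0; apply: wp_frame => //; apply: wp_imp
  (@wp_while _ _ _ M b w e c t N (fun i s' => frame s s' /\ I i s') s _ _) => //.
  by move=> s' [i [? [_ ?] ?]]; exists i.
move=> i s1 [F Ii] e_s1; have [lt_i wp_c] := body i s1 F Ii e_s1; split=> //.
by apply: wp_imp (wp_frame wr_c wp_c) => s2 [F2 I2]; split=> //; apply: frame_trans F2.
Qed.

(** The rule for counting loops: the test is true exactly before iteration [N], and the body may
    assume that everything outside its footprint is as it was before the loop. *)
Lemma wp_for_frame e c t (N : nat) (I : nat -> state R -> Prop) s :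
  writes_within c ->
  (forall i s', (i <= N)%N -> frame s s' -> I i s' -> beval M b s' e = (i < N)%N) ->
  (forall i s', (i < N)%N -> frame s s' -> I i s' -> wp M b w c t (I i.+1) s') ->
  I 0%N s ->
  wp M b w (CWhile e c) (N * t.+1).+1 (fun s' => frame s s' /\ I N s') s.
Proof.
move=> wr_c test body I0; apply: wp_imp
  (@wp_while_frame e c t N (fun i s' => (i <= N)%N /\ I i s') s wr_c _ _) => //.
  move=> s' [F [i [_ [le_i Ii]]]]; rewrite (test i) // -leqNgt => le_Ni.
  by have <- : i = N by apply/eqP; rewrite eqn_leq le_i.
move=> i s1 F [le_i Ii]; rewrite (test i) // => lt_i; split=> //.
by apply: wp_imp (body i s1 lt_i F Ii).
Qed.

End Frame.

(** * Rewriting rules for straight-line code *)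

Section Denote.
Variables (R : realType) (n m : nat) (M : market R n m).
Variables (b : 'I_n -> R) (w : nat -> bool).
Local Notation denote := (denote M b w).

Lemma denote_seq c1 c2 s : denote (CSeq c1 c2) s = denote c2 (denote c1 s).
Proof. by []. Qed.

Lemma denote_if e c1 c2 s :
  denote (CIf e c1 c2) s = if beval M b s e then denote c1 s else denote c2 s.
Proof. by []. Qed.

Lemma denote_skip s : denote CSkip s = s.
Proof. by []. Qed.

Lemma denote_setN a e s : denote (CSetN a e) s =
  State [eta nmem s with neval M s a |-> neval M s e]
    (rmem s) (coins s) (owner s) (payment s).
Proof. by []. Qed.

Lemma denote_setR a e s : denote (CSetR a e) s =
  State (nmem s) [eta rmem s with neval M s a |-> reval M b s e]
    (coins s) (owner s) (payment s).
Proof. by []. Qed.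

Lemma denote_flip a s : denote (CFlip a) s =
  State [eta nmem s with neval M s a |-> w (coins s) : nat]
    (rmem s) (coins s).+1 (owner s) (payment s).
Proof. by []. Qed.

Lemma denote_give a e s : denote (CGive a e) s =
  State (nmem s) (rmem s) (coins s)
    [eta owner s with neval M s a |-> Some (neval M s e)] (payment s).
Proof. by []. Qed.

Lemma denote_charge a e s : denote (CCharge a e) s =
  State (nmem s) (rmem s) (coins s) (owner s)
    [eta payment s with neval M s a |-> reval M b s e].
Proof. by []. Qed.

Definition denoteE := (denote_skip, denote_setN, denote_setR, denote_flip,
  denote_give, denote_charge).

End Denote.

Arguments denote : simpl never.

Notation "c1 ;; c2"  := (CSeq c1 c2) (at level 61, right associativity).

(** * Code of the mechanism *)

Definition var (r : nat) : nexp := NMem (NConst r).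
Definition array (r : nat) (e : nexp) : nexp := NMem (cell r e).
Definition set_var (r : nat) (e : nexp) : cmd := CSetN (NConst r) e.
Definition incr (r : nat) : cmd := set_var r (NAdd (var r) (NConst 1)).
Definition rvar (q : nat) : rexp := RMem (NConst q).
Definition set_rvar (q : nat) (e : rexp) : cmd := CSetR (NConst q) e.
Definition blt (e1 e2 : nexp) : bexp := BLeN (NAdd e1 (NConst 1)) e2.
Definition blt_real (e1 e2 : rexp) : bexp := BNot (BLeR e2 e1).
Definition is_true_var (r : nat) : bexp := BLeN (NConst 1) (var r).
Definition bor (e1 e2 : bexp) : bexp := BNot (BAnd (BNot e1) (BNot e2)).
Definition bneq (e1 e2 : nexp) : bexp := bor (blt e1 e2) (blt e2 e1).

(** Prefix [v_] marks a scalar natural, kept in the first cell of its region, [r_] an array filling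
    a region, and [q_] a cell of the real memory. *)
Notation v_i := 0%N (only parsing).
Notation v_deg := 1%N (only parsing).
Notation v_half := 2%N (only parsing).
Notation v_cap := 3%N (only parsing).
Notation v_off := 4%N (only parsing).
Notation v_type := 5%N (only parsing).
Notation v_count := 6%N (only parsing).
Notation v_a := 7%N (only parsing).
Notation v_c := 8%N (only parsing).
Notation v_bit := 9%N (only parsing).
Notation v_done := 10%N (only parsing).
Notation r_sampled := 11%N (only parsing).
Notation r_list := 12%N (only parsing).
Notation r_digit := 13%N (only parsing).
Notation r_best := 14%N (only parsing).
Notation q_price := 0%N (only parsing).
Notation q_slots := 1%N (only parsing).
Notation q_factor := 2%N (only parsing).
Notation q_score := 3%N (only parsing).
Notation q_best := 4%N (only parsing).

(** Equality of two truth values, the self-loop status of bidder [v_i] and the type coin, spelled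
    out as two implications. *)
Definition right_type : bexp :=
  let loop := BConflict (var v_i) (var v_i) in
  BAnd (bor loop (BNot (is_true_var v_type)))
       (bor (BNot loop) (is_true_var v_type)).

Definition sample_bidders : cmd :=
  CWhile (blt (var v_i) NBidders)
   (CFlip (cell r_sampled (var v_i)) ;;
    CIf (BLeN (var v_deg) (NOutdeg (var v_i)))
      (set_var v_deg (NOutdeg (var v_i))) CSkip ;;
    CIf (BAnd (BLeN (NConst 1) (array r_sampled (var v_i)))
          (BAnd right_type (BLeR (rvar q_price) (RReport (var v_i)))))
      (set_rvar q_price (RReport (var v_i))) CSkip ;;
    incr v_i).

(** Naturals can be neither halved, nor multiplied, nor converted to reals. One loop thus counts up
    to half of [m], rounded up, and accumulates alongside the list capacity and, as a real, twice
    the count. *)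
Definition count_slots : cmd :=
  CWhile (blt (NAdd (var v_half) (var v_half)) NSlots)
   (incr v_half ;;
    set_var v_cap (NAdd (var v_cap)
      (NAdd (NAdd (var v_deg) (var v_deg)) (NConst 1))) ;;
    set_rvar q_slots (RAdd (rvar q_slots) (RConst 2))).

Definition choose_block : cmd :=
  CIf (is_true_var v_off) (set_var v_off (NSub NSlots (var v_half))) CSkip.

(** Squaring makes the factor of round [j] equal to [2 ^ (2 ^ j)], so that few coins select an
    exponent uniformly from an exponentially larger range. *)
Definition lower_price : cmd :=
  CWhile (blt_real (rvar q_factor) (rvar q_slots))
   (CFlip (NConst v_bit) ;;
    CIf (is_true_var v_bit)
      (set_rvar q_price (RDiv (rvar q_price) (rvar q_factor))) CSkip ;;
    set_rvar q_factor (RMul (rvar q_factor) (rvar q_factor))).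

Definition select_bidders : cmd :=
  CWhile (blt (var v_i) NBidders)
   (CIf (BAnd (blt (var v_count) (var v_cap))
          (BAnd (BNot (BLeN (NConst 1) (array r_sampled (var v_i))))
            (BAnd (blt_real (rvar q_price) (RReport (var v_i))) right_type)))
      (incr v_count ;; CSetN (cell r_list (var v_count)) (var v_i)) CSkip ;;
    incr v_i).

Definition slot_rate (a : nexp) : rexp := RCtr (NAdd (var v_off) a).

Definition sum_rates : cmd :=
  CWhile (blt (var v_a) (var v_half))
   (CIf (BLeN (NConst 1) (array r_digit (var v_a)))
      (set_rvar q_score (RAdd (rvar q_score) (slot_rate (var v_a)))) CSkip ;;
    incr v_a).

Definition clash_test : bexp :=
  bor (BAnd (bneq (var v_a) (var v_c))
        (BAnd (BNot (bneq (array r_digit (var v_a)) (array r_digit (var v_c))))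
              (BLeN (NConst 1) (array r_digit (var v_a)))))
      (BAnd (BConflict (array r_list (array r_digit (var v_a)))
                       (array r_list (array r_digit (var v_c))))
            (BSlotConflict (NAdd (var v_off) (var v_a))
                           (NAdd (var v_off) (var v_c)))).

Definition reject_clashes : cmd :=
  CWhile (blt (var v_a) (var v_half))
   (set_var v_c (NConst 0) ;;
    CWhile (blt (var v_c) (var v_half))
     (CIf clash_test (set_rvar q_score (RConst 0)) CSkip ;; incr v_c) ;;
    incr v_a).

Definition save_best : cmd :=
  CWhile (blt (var v_a) (var v_half))
   (CSetN (cell r_best (var v_a)) (array r_digit (var v_a)) ;; incr v_a).

(** The base is the list size plus one, so [v_count] is the largest digit. *)
Definition carry : cmd :=
  CWhile (BAnd (blt (var v_a) (var v_half))
               (BLeN (var v_count) (array r_digit (var v_a))))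
   (CSetN (cell r_digit (var v_a)) (NConst 0) ;; incr v_a).

Definition search_body : cmd :=
  set_rvar q_score (RConst 0) ;; set_var v_a (NConst 0) ;; sum_rates ;;
  set_var v_a (NConst 0) ;; reject_clashes ;;
  set_var v_a (NConst 0) ;;
  CIf (blt_real (rvar q_best) (rvar q_score))
    (set_rvar q_best (rvar q_score) ;; save_best) CSkip ;;
  set_var v_a (NConst 0) ;; carry ;;
  CIf (blt (var v_a) (var v_half))
    (CSetN (cell r_digit (var v_a)) (NAdd (array r_digit (var v_a)) (NConst 1)))
    (set_var v_done (NConst 1)).

Definition search : cmd := CWhile (BLeN (var v_done) (NConst 0)) search_body.

Definition best_holder (a : nexp) : nexp := array r_list (array r_best a).

(** An unassigned slot is given and charged to the nonexistent bidder [n], whom the output ignores.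
    Overwriting a payment is harmless, as a real bidder holds at most one slot. *)
Definition sell_slots : cmd :=
  CWhile (blt (var v_a) (var v_half))
   (CGive (NAdd (var v_off) (var v_a)) (best_holder (var v_a)) ;;
    CCharge (best_holder (var v_a)) (RMul (rvar q_price) (slot_rate (var v_a))) ;;
    incr v_a).

(* Coin 0 chooses the half of the slots, coin 1 the self-loop status of the
   admitted bidders, coin 2 + i whether bidder i is sampled; the remaining coins
   are the binary digits of the exponent t. *)
Definition program : cmd :=
  CFlip (NConst v_off) ;; CFlip (NConst v_type) ;; sample_bidders ;;
  count_slots ;; choose_block ;;
  set_rvar q_factor (RConst 2) ;; lower_price ;;
  set_var v_i (NConst 0) ;; CSetN (cell r_list (NConst 0)) NBidders ;; select_bidders ;;
  search ;; set_var v_a (NConst 0) ;; sell_slots.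

(** * Correctness of the program *)

(* Otherwise simplification would duplicate states in conditionals. *)
Opaque cell denote.

Ltac eval_state := rewrite /= ?neval_cell /= ?(eq_addr, eq_addr0, eq_0addr) //=.

Ltac writes := repeat first
  [ done | split
  | eexists; [| first [left; reflexivity | right; eexists; reflexivity | reflexivity]]; done ].

(** * Sampling, pricing and selection *)

Section Run.
Variables (R : realType) (n m : nat) (M : market R n m).
Variables (b : 'I_n -> R) (w : nat -> bool).
Local Notation wp := (wp M b w).

Definition type_ok (i : nat) : bool := lookup2 (conflict M) i i == w 1.

Lemma right_typeE s : nmem s v_type = w 1%N -> beval M b s right_type = type_ok (nmem s v_i).
Proof.
by move=> def_t; rewrite /right_type /type_ok /= def_t; case: (lookup2 _ _ _); case: (w 1).
Qed.

Opaque right_type.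

Fixpoint sample_max (i : nat) : R :=
  if i is j.+1 then
    if w (2 + j)%N && type_ok j then Num.max (sample_max j) (lookup 0 b j)
    else sample_max j
  else 0.

Lemma wp_sample s :
  coins s = 2 -> nmem s v_i = 0%N -> nmem s v_deg = 0%N -> nmem s v_type = w 1%N ->
  rmem s q_price = 0 ->
  wp sample_bidders (n * 20).+1 (fun s' =>
    frame [:: v_i; v_deg; r_sampled] [:: q_price] true false s s' /\
    [/\ coins s' = (2 + n)%N, nmem s' v_deg = max_outdeg M,
        forall j, (j < n)%N -> nmem s' (addr r_sampled j) = w (2 + j)%N &
        rmem s' q_price = sample_max n]) s.
Proof.
move=> coins2 i0 deg0 type_s price0.
pose I i (s' : state R) := [/\ nmem s' v_i = i, coins s' = (2 + i)%N,
  nmem s' v_deg = \max_(j < i) lookup 0%N (outdeg M) j,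
  forall j, (j < i)%N -> nmem s' (addr r_sampled j) = w (2 + j)%N &
  rmem s' q_price = sample_max i].
have : wp sample_bidders (n * 20).+1 (fun s' =>
    frame [:: v_i; v_deg; r_sampled] [:: q_price] true false s s' /\ I n s') s.
  apply: wp_for_frame.
  - writes.
  - by move=> i s' _ _ [i_s _ _ _ _] /=; rewrite i_s addn1.
  - move=> i s' lt_i F [i_s coins_s deg_s sampled_s price_s].
    have type_s' : nmem s' v_type = w 1%N by rewrite (frame_var F).
    apply: wp_le (wp_denote _ _) => //.
    rewrite denote_seq denote_flip; eval_state; rewrite i_s coins_s.
    have sampled_i j : (j < i.+1)%N -> j != i -> nmem s' (addr r_sampled j) = w (2 + j)%N.
      by rewrite ltnS leq_eqVlt => /predU1P[->|/sampled_s//]; rewrite eqxx.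
    rewrite denote_seq denote_if; eval_state; rewrite deg_s i_s.
    case: leqP => le_deg; rewrite denoteE; eval_state;
      rewrite denote_seq denote_if /= right_typeE //=; eval_state;
      rewrite i_s eqxx lt0b price_s; case: ifPn => cond; rewrite !denoteE; eval_state;
      rewrite /I; eval_state; rewrite ?i_s ?addn1 ?addnS;
      (split=> //;
       [ rewrite big_ord_recr ?deg_s; apply/esym; solve [exact/maxn_idPr | exact/maxn_idPl/ltnW]
       | by move=> j lt_j; eval_state; case: eqVneq => [->|/sampled_i->]
       | move: cond; rewrite ?price_s; case: (w _) => //=; case: type_ok => //=; case: leP => //]).
  - by split=> //; rewrite /sample_max ?big_ord0.
apply: wp_imp => s' [F [_ coins_s' deg_s' sampled_s' price_s']]; split=> //; split=> //.
by rewrite deg_s'; apply: eq_bigr => i _; rewrite lookup_ord.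
Qed.

Lemma wp_count s : nmem s v_half = 0%N -> nmem s v_cap = 0%N ->
  nmem s v_deg = max_outdeg M -> rmem s q_slots = 0 ->
  wp count_slots (uphalf m * 20).+1 (fun s' =>
    frame [:: v_half; v_cap] [:: q_slots] false false s s' /\
    [/\ nmem s' v_half = uphalf m, nmem s' v_cap = capacity M (uphalf m) &
        rmem s' q_slots = (uphalf m).*2%:R]) s.
Proof.
move=> half0 cap0 deg_s slots0.
apply: (@wp_for_frame _ _ _ _ _ _ _ _ _ _ _ _ _ _ (fun i s' =>
  [/\ nmem s' v_half = i, nmem s' v_cap = capacity M i & rmem s' q_slots = i.*2%:R])).
- writes.
- by move=> i s' _ _ [i_s _ _] /=; rewrite i_s; lia.
- move=> i s' lt_i F [i_s cap_s slots_s].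
  have deg_s' : nmem s' v_deg = max_outdeg M by rewrite (frame_var F).
  apply: wp_le (wp_denote _ _) => //.
  rewrite !denote_seq !denoteE; eval_state; rewrite i_s cap_s deg_s' slots_s.
  by split; [lia | rewrite /capacity; lia | rewrite -natrD doubleS addn2].
- by [].
Qed.

(** The two possible blocks cover all slots; for odd [m] they share the middle one. *)
Definition block_offset : nat := if w 0 then (m - uphalf m)%N else 0%N.

Lemma threshold_coins_ex : exists q, ((uphalf m).*2 <= 2 ^ (2 ^ q))%N.
Proof.
exists m; apply: leq_trans (ltnW (ltn_expl _ (ltnSn 1))).
by apply: leq_trans (ltn_expl m (ltnSn 1)); lia.
Qed.

(** The number [q] of rounds of [lower_price]; minimality keeps [2 ^ q] of order [log m]. *)
Definition threshold_coins : nat := ex_minn threshold_coins_ex.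

Lemma threshold_coinsP i : (i <= threshold_coins)%N ->
  (2 ^ (2 ^ i) < (uphalf m).*2)%N = (i < threshold_coins)%N.
Proof.
rewrite /threshold_coins; case: ex_minnP => q le_q min_q le_i.
rewrite ltnNge [in RHS]ltnNge; congr negb; apply/idP/idP => [/min_q//|le_qi].
by have -> : i = q by lia.
Qed.

Fixpoint price_after (i : nat) : R :=
  if i is j.+1 then
    if w (2 + n + j)%N then price_after j / (2 ^ (2 ^ j))%:R else price_after j
  else sample_max n.

Definition price : R := price_after threshold_coins.

Lemma wp_lower s : coins s = (2 + n)%N -> rmem s q_price = sample_max n ->
  rmem s q_factor = 2 -> rmem s q_slots = (uphalf m).*2%:R ->
  wp lower_price (threshold_coins * 20).+1 (fun s' =>
    frame [:: v_bit] [:: q_price; q_factor] true false s s' /\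
    rmem s' q_price = price) s.
Proof.
move=> coins_s price_s factor_s slots_s.
have : wp lower_price (threshold_coins * 20).+1 (fun s' =>
    frame [:: v_bit] [:: q_price; q_factor] true false s s' /\
    [/\ coins s' = (2 + n + threshold_coins)%N, rmem s' q_price = price &
        rmem s' q_factor = (2 ^ (2 ^ threshold_coins))%:R]) s.
  apply: (@wp_for_frame _ _ _ _ _ _ _ _ _ _ _ _ _ _ (fun i s' =>
  [/\ coins s' = (2 + n + i)%N, rmem s' q_price = price_after i &
     rmem s' q_factor = (2 ^ (2 ^ i))%:R])).
  - writes.
  - move=> i s' le_i F [_ _ factor_i] /=.
    by rewrite factor_i (frame_rmem F) // slots_s ler_nat -ltnNge threshold_coinsP.
  - move=> i s' lt_i F [coins_i price_i factor_i].
    apply: wp_le (wp_denote _ _) => //.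
    rewrite denote_seq denoteE; eval_state; rewrite denote_seq denote_if; eval_state; rewrite lt0b coins_i.
    have sq_factor : (2 ^ (2 ^ i))%:R * (2 ^ (2 ^ i))%:R = (2 ^ (2 ^ i.+1))%:R :> R.
      by rewrite -natrM -expnD addnn -mul2n -expnS.
    by case: ifP => w_i; rewrite !denoteE; eval_state; rewrite ?price_i factor_i sq_factor addnS.
  - by split; rewrite ?addn0.
by apply: wp_imp => s' [F [_ ? _]].
Qed.

Definition eligible (i : nat) : bool :=
  [&& ~~ w (2 + i)%N, price < lookup 0 b i & type_ok i].

Local Notation K := (capacity M (uphalf m)).

Lemma wp_select s : nmem s v_i = 0%N -> nmem s v_count = 0%N ->
  nmem s v_cap = K -> nmem s v_type = w 1%N ->
  (forall j, (j < n)%N -> nmem s (addr r_sampled j) = w (2 + j)%N) ->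
  rmem s q_price = price -> nmem s (addr r_list 0) = n ->
  let lst := shortlist M (uphalf m) eligible in
  wp select_bidders (n * 30).+1 (fun s' =>
    frame [:: v_i; v_count; r_list] [::] false false s s' /\
    nmem s' v_count = size lst /\
    forall d, (d <= size lst)%N -> nmem s' (addr r_list d) = nth n (n :: lst) d) s.
Proof.
move=> i0 count0 cap_s type_s sampled_s price_s list0 lst.
(* The list once the bidders below [i] have been examined; stopping at a full list amounts to
   truncating the filtered sequence. *)
pose sel i := take K [seq j <- iota 0 i | eligible j].
have selS i : sel i.+1 =
    if (size (sel i) < K)%N && eligible i then rcons (sel i) i else sel i.
  rewrite /sel -addn1 iotaD filter_cat /= add0n; case: (eligible i); last first.
    by rewrite andbF cats0.
  rewrite andbT take_cat size_take; case: (ltnP K) => [lt_K|le_K].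
    by rewrite ltnn.
  case: ltnP => [lt_K|ge_K].
    by rewrite !take_oversize ?cats1 //= ?subn_gt0 // ltnW.
  have -> : K = size [seq j <- iota 0 i | eligible j] by lia.
  by rewrite subnn take0 cats0 take_size.
have : wp select_bidders (n * 30).+1 (fun s' =>
    frame [:: v_i; v_count; r_list] [::] false false s s' /\
    [/\ nmem s' v_i = n, nmem s' v_count = size (sel n) &
    forall d, (d <= size (sel n))%N -> nmem s' (addr r_list d) = nth n (n :: sel n) d]) s.
  apply: (@wp_for_frame _ _ _ _ _ _ _ _ _ _ _ _ _ _ (fun i s' =>
    [/\ nmem s' v_i = i, nmem s' v_count = size (sel i) &
    forall d, (d <= size (sel i))%N -> nmem s' (addr r_list d) = nth n (n :: sel i) d])).
  - writes.
  - by move=> i s' _ _ [i_s _ _] /=; rewrite i_s addn1.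
  - move=> i s' lt_i F [i_s count_i list_i].
    apply: wp_le (wp_denote _ _) => //.
    have type_s' : nmem s' v_type = w 1%N by rewrite (frame_var F).
    have cap_s' : nmem s' v_cap = K by rewrite (frame_var F).
    have sampled_i : nmem s' (addr r_sampled i) = w (2 + i)%N.
      by rewrite (frame_cell F) // sampled_s.
    rewrite denote_seq denote_if; eval_state; rewrite right_typeE // i_s count_i cap_s'.
    rewrite sampled_i lt0b (frame_rmem F) // price_s -ltNge addn1.
    have -> : [&& (size (sel i) < K)%N, ~~ w (2 + i)%N, price < lookup 0 b i & type_ok i]
       = (size (sel i) < K)%N && eligible i by [].
    case: ifPn => cond.
      rewrite !denote_seq !denoteE; eval_state; rewrite selS cond i_s count_i addn1 size_rcons.
      split=> //; first by rewrite addn1.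
      move=> d le_d; eval_state; rewrite -rcons_cons nth_rcons /= ltnS.
      case: eqVneq => [->|neq_d]; first by rewrite addn1 ltnn eqxx.
      by rewrite ifT ?list_i //; move: neq_d; rewrite addn1; lia.
    rewrite !denoteE; eval_state; rewrite selS (negPf cond) i_s count_i addn1.
    by split=> // d le_d; eval_state; rewrite list_i.
  - by split=> // -[|d] //; rewrite list0.
by apply: wp_imp => s' [F [_ ? ?]].
Qed.

End Run.

(** * The search loop *)

Section RunSearch.
Variables (R : realType) (n m : nat) (M : market R n m).
Variables (b : 'I_n -> R) (w : nat -> bool).
Variables (lst : seq nat) (off h : nat).
Local Notation wp := (wp M b w).
Local Notation denote := (denote M b w).

Local Notation B := (size lst).+1.
Local Notation score := (score M lst off h).
Local Notation best_code := (best_code M lst off h).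

Record search_inputs (s : state R) : Prop := SearchInputs {
  si_half : nmem s v_half = h;
  si_off : nmem s v_off = off;
  si_count : nmem s v_count = size lst;
  si_list : forall d, (d <= size lst)%N -> nmem s (addr r_list d) = nth n (n :: lst) d
}.

Lemma frame_inputs rs qs fl out s s' : frame rs qs fl out s s' ->
  all [in [:: v_a; v_c; v_done; r_digit; r_best]] rs ->
  search_inputs s -> search_inputs s'.
Proof.
move=> F /allP rs_ok [? ? ? list_s].
have out_rs r : r \notin [:: v_a; v_c; v_done; r_digit; r_best] -> r \notin rs.
  by apply: contra => /rs_ok.
split; rewrite ?(frame_var F) ?out_rs //.
by move=> d le_d; rewrite (frame_cell F) ?out_rs // list_s.
Qed.

Definition digits_of (x : nat) (s : state R) : Prop :=
  forall a, (a < h)%N -> nmem s (addr r_digit a) = digit B x a.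

Lemma frame_digits x rs qs fl out s s' : frame rs qs fl out s s' ->
  r_digit \notin rs -> digits_of x s -> digits_of x s'.
Proof. by move=> F rs_ok dig_s a lt_a; rewrite (frame_cell F) // dig_s. Qed.

Lemma wp_sum_rates x s : search_inputs s -> digits_of x s ->
  nmem s v_a = 0%N -> rmem s q_score = 0 ->
  wp sum_rates (h * 20).+1 (fun s' =>
    frame [:: v_a] [:: q_score] false false s s' /\
    rmem s' q_score = \sum_(a < h | digit B x a != 0%N) lookup 0 (ctr M) (off + a)) s.
Proof.
move=> in_s dig_s a0 score0.
have : wp sum_rates (h * 20).+1 (fun s' =>
    frame [:: v_a] [:: q_score] false false s s' /\
    [/\ nmem s' v_a = h & rmem s' q_score =
       \sum_(a < h | digit B x a != 0%N) lookup 0 (ctr M) (off + a)]) s.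
  apply: (@wp_for_frame _ _ _ _ _ _ _ _ _ _ _ _ _ _ (fun i s' =>
    [/\ nmem s' v_a = i & rmem s' q_score =
       \sum_(a < i | digit B x a != 0%N) lookup 0 (ctr M) (off + a)])).
  - writes.
  - move=> i s' _ F [a_i _]; have [half_s' _ _ _] := frame_inputs F isT in_s.
    by rewrite /= a_i half_s' addn1.
  - move=> i s' lt_i F [a_i score_i].
    have [_ off_s' _ _] := frame_inputs F isT in_s.
    have dig_i := frame_digits F isT dig_s lt_i.
    apply: wp_le (wp_denote _ _) => //.
    rewrite denote_seq denote_if; eval_state; rewrite a_i dig_i lt0n.
    case: ifPn => dig_x; rewrite !denoteE; eval_state; rewrite a_i addn1; split=> //;
      rewrite big_mkcond big_ord_recr -big_mkcond /= ?off_s' score_i.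
      by rewrite dig_x.
    by rewrite (negPf dig_x) addr0.
  - by rewrite big_ord0.
by apply: wp_imp => s' [F [_ ?]].
Qed.

Lemma clash_testE x s : search_inputs s -> digits_of x s ->
  (nmem s v_a < h)%N -> (nmem s v_c < h)%N ->
  beval M b s clash_test = clash M lst off x (nmem s v_a) (nmem s v_c).
Proof.
move=> [_ off_s _ list_s] dig_s lt_a lt_c.
have dig_le a : (digit B x a <= size lst)%N by rewrite -ltnS ltn_mod.
rewrite /clash_test /= !neval_cell /= !neval_cell /= !dig_s // !list_s // off_s.
have neqE (i j : nat) : ~~ (~~ (i + 1 <= j)%N && ~~ (j + 1 <= i)%N) = (i != j) by lia.
by rewrite !neqE negb_and !negbK lt0n.
Qed.

Lemma wp_reject_clashes x s : search_inputs s -> digits_of x s ->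
  nmem s v_a = 0%N ->
  wp reject_clashes (h * (h * 20 + 20)).+1 (fun s' =>
    frame [:: v_a; v_c] [:: q_score] false false s s' /\
    rmem s' q_score = if clashing M lst off h x then 0 else rmem s q_score) s.
Proof.
move=> in_s dig_s a0.
pose found i := has (fun a => has (clash M lst off x a) (iota 0 h)) (iota 0 i).
have : wp reject_clashes (h * (h * 20 + 20)).+1 (fun s' =>
    frame [:: v_a; v_c] [:: q_score] false false s s' /\
    [/\ nmem s' v_a = h & rmem s' q_score = if found h then 0 else rmem s q_score]) s.
  apply: wp_le (_ : ((h * (h * 20 + 15).+1).+1 <= _)%N) _; first by lia.
  apply: (@wp_for_frame _ _ _ _ _ _ _ _ _ _ _ _ _ _ (fun i s' =>
    [/\ nmem s' v_a = i & rmem s' q_score = if found i then 0 else rmem s q_score])).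
  - writes.
  - move=> i s' _ F [a_i _]; have [half_s' _ _ _] := frame_inputs F isT in_s.
    by rewrite /= a_i half_s' addn1.
  - move=> i s' lt_i F [a_i score_i].
    have in_s' := frame_inputs F isT in_s; have dig_s' := frame_digits F isT dig_s.
    apply: wp_le (_ : ((cost (set_var v_c (NConst 0)) + ((h * 15.+1).+1 + cost (incr v_a)).+1).+1
      <= _)%N) _; first by rewrite /=; lia.
    apply: wp_seq; apply: wp_denote => //; apply: wp_seq; rewrite denoteE /=.
    set s1 := State _ _ _ _ _.
    have F1 : frame [:: v_a; v_c] [:: q_score] false false s' s1.
      by split=> //= r j lt_r; rewrite eq_addr0 //; case: r lt_r => [|[|[|[|[|[|[|[|[|r]]]]]]]]].
    have in_s1 := frame_inputs F1 isT in_s'; have dig_s1 := frame_digits F1 isT dig_s'.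
    have : wp (CWhile (blt (var v_c) (var v_half))
        (CIf clash_test (set_rvar q_score (RConst 0)) CSkip ;; incr v_c)) (h * 15.+1).+1
        (fun s2 => frame [:: v_c] [:: q_score] false false s1 s2 /\
          [/\ nmem s2 v_c = h & rmem s2 q_score =
           if has (clash M lst off x i) (iota 0 h) then 0 else rmem s1 q_score]) s1.
      apply: (@wp_for_frame _ _ _ _ _ _ _ _ _ _ _ _ _ _ (fun j s2 =>
        [/\ nmem s2 v_c = j & rmem s2 q_score =
         if has (clash M lst off x i) (iota 0 j) then 0 else rmem s1 q_score])).
      + writes.
      + move=> j s2 _ F2 [c_j _]; have [half_s2 _ _ _] := frame_inputs F2 isT in_s1.
        by rewrite /= c_j half_s2 addn1.
      + move=> j s2 lt_j F2 [c_j score_j].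
        have in_s2 := frame_inputs F2 isT in_s1; have dig_s2 := frame_digits F2 isT dig_s1.
        have a_s2 : nmem s2 v_a = i by rewrite (frame_var F2).
        apply: wp_le (wp_denote _ _) => //.
        rewrite denote_seq denote_if (clash_testE in_s2 dig_s2) ?a_s2 ?c_j //.
        rewrite -[in iota 0 j.+1]addn1 iotaD has_cat /= orbF add0n.
        case: ifPn => clash_j; rewrite !denoteE; eval_state; rewrite c_j addn1; split=> //.
          by rewrite orbT.
        by rewrite orbF.
      + by [].
    apply: wp_imp => s2 [F2 [_ score_s2]]; apply: wp_denote => //; rewrite !denoteE; eval_state.
    have a_s2 : nmem s2 v_a = i by rewrite (frame_var F2).
    rewrite a_s2 addn1; split=> //; rewrite score_s2 /= score_i /found.
    rewrite -[in iota 0 i.+1]addn1 iotaD has_cat /= orbF add0n.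
    by case: (has _ (iota 0 i)); case: (has _ (iota 0 h)).
  - by [].
by apply: wp_imp => s' [F [_ ?]].
Qed.

Lemma wp_save_best x s : search_inputs s -> digits_of x s ->
  nmem s v_a = 0%N ->
  wp save_best (h * 20).+1 (fun s' =>
    frame [:: v_a; r_best] [::] false false s s' /\
    forall a, (a < h)%N -> nmem s' (addr r_best a) = digit B x a) s.
Proof.
move=> in_s dig_s a0.
have : wp save_best (h * 20).+1 (fun s' =>
    frame [:: v_a; r_best] [::] false false s s' /\
    [/\ nmem s' v_a = h &
     forall a, (a < h)%N -> nmem s' (addr r_best a) = digit B x a]) s.
  apply: (@wp_for_frame _ _ _ _ _ _ _ _ _ _ _ _ _ _ (fun i s' =>
    [/\ nmem s' v_a = i &
     forall a, (a < i)%N -> nmem s' (addr r_best a) = digit B x a])).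
  - writes.
  - move=> i s' _ F [a_i _]; have [half_s' _ _ _] := frame_inputs F isT in_s.
    by rewrite /= a_i half_s' addn1.
  - move=> i s' lt_i F [a_i best_i].
    have dig_i := frame_digits F isT dig_s lt_i.
    apply: wp_le (wp_denote _ _) => //.
    rewrite denote_seq !denoteE; eval_state; rewrite a_i addn1; split=> // a lt_a; eval_state.
    by case: eqVneq => [->//|neq_a]; apply: best_i; lia.
  - by [].
by apply: wp_imp => s' [F [_ ?]].
Qed.

(** The position [i] where the loop stops is that of the first digit that is not maximal, or [h]
    when there is none. *)
Lemma wp_carry x s : search_inputs s -> digits_of x s -> nmem s v_a = 0%N ->
  wp carry (h * 20).+1 (fun s' =>
    frame [:: v_a; r_digit] [::] false false s s' /\
    exists i, [/\ (i <= h)%N, nmem s' v_a = i,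
      forall a, (a < i)%N -> digit B x a = B.-1,
      (i < h)%N -> (digit B x i < B.-1)%N &
      forall a, (a < h)%N ->
        nmem s' (addr r_digit a) = if (a < i)%N then 0%N else digit B x a]) s.
Proof.
move=> in_s dig_s a0.
pose I i (s' : state R) := [/\ (i <= h)%N, nmem s' v_a = i,
      forall a, (a < i)%N -> digit B x a = B.-1 &
      forall a, (a < h)%N ->
        nmem s' (addr r_digit a) = if (a < i)%N then 0%N else digit B x a].
apply: wp_imp (@wp_while_frame _ _ _ _ _ _ [:: v_a; r_digit] [::] false false
  _ _ 19 h I _ _ _ _); first last.
- by [].
- move=> i s' F [le_i a_i max_i dig_i].
  have [half_s' _ count_s' _] := frame_inputs F isT in_s.
  rewrite /= neval_cell /= a_i half_s' count_s' addn1 => /andP[lt_i].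
  rewrite dig_i // ltnn => max_d; split=> //.
  apply: wp_le (wp_denote _ _) => //; rewrite denote_seq !denoteE; eval_state.
  rewrite a_i addn1; split=> // a; last first.
    move=> lt_a; eval_state; rewrite dig_i // ltnS [(a <= i)%N]leq_eqVlt.
    by case: (a == i).
  rewrite ltnS leq_eqVlt => /predU1P[->|/max_i//].
  by apply/eqP; rewrite eqn_leq max_d -ltnS ltn_mod.
- writes.
move=> s' [F [i [_ [le_i a_i max_i dig_i]]]].
have [half_s' _ count_s' _] := frame_inputs F isT in_s.
rewrite /= neval_cell /= a_i half_s' count_s' addn1 => exit_i; split=> //.
exists i; split=> // lt_i.
by move: exit_i; rewrite lt_i dig_i // ltnn /= -ltnNge.
Qed.

(* x is the current code, y the code of the best assignment so far. *)
Record search_state (x y : nat) (s : state R) : Prop := SearchState {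
  ss_inputs : search_inputs s;
  ss_digits : digits_of x s;
  ss_best : forall a, (a < h)%N -> nmem s (addr r_best a) = digit B y a;
  ss_score : rmem s q_best = score y;
  ss_done : nmem s v_done = 0%N
}.

Lemma frame_state x y rs qs s s' : frame rs qs false false s s' ->
  all [in [:: v_a; v_c]] rs -> all [in [:: q_score]] qs ->
  search_state x y s -> search_state x y s'.
Proof.
move=> F /allP rs_ok /allP qs_ok [in_s dig_s best_s score_s done_s].
have out_rs r : r \notin [:: v_a; v_c] -> r \notin rs by apply: contra => /rs_ok.
have out_qs q : q \notin [:: q_score] -> q \notin qs by apply: contra => /qs_ok.
split.
- apply: frame_inputs F _ in_s; apply/allP => r /rs_ok.
  by rewrite !inE => /orP[->|->]; rewrite ?orbT.
- by apply: frame_digits F _ dig_s; apply: out_rs.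
- by move=> a lt_a; rewrite (frame_cell F) ?out_rs // best_s.
- by rewrite (frame_rmem F) ?out_qs.
- by rewrite (frame_var F) ?out_rs.
Qed.

Lemma wp_reset_a s : wp (set_var v_a (NConst 0)) 1
  (fun s' => frame [:: v_a] [::] false false s s' /\ nmem s' v_a = 0%N) s.
Proof. by apply: wp_frame; [writes | apply: wp_denote; rewrite ?denoteE]. Qed.

(** One iteration scores code [x], updates the best code and moves on to the next one. Past the last
    code the digits overflow, and this raises the flag that ends the loop. *)
Lemma wp_search_body x s : (x < B ^ h)%N -> search_state x (best_code x) s ->
  wp search_body ((h * h + 1) * 150)
    (fun s' => if (x.+1 < B ^ h)%N then search_state x.+1 (best_code x.+1) s'
     else (0 < nmem s' v_done)%N /\
          forall a, (a < h)%N -> nmem s' (addr r_best a) = digit B (best_code x.+1) a) s.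
Proof.
(* The time bound is left open, assembled by the rules, and compared with the claimed one at the
   end. *)
move=> lt_x st_s; eapply wp_le; last first.
  apply: wp_seq; apply: wp_imp (_ : wp _ 1 (fun s' =>
    frame [::] [:: q_score] false false s s' /\ rmem s' q_score = 0) s); last first.
    by apply: wp_frame; [writes | apply: wp_denote; rewrite ?denoteE].
  move=> s1 [/frame_state/(_ isT isT st_s) {}st_s score_s1].
  apply: wp_seq; apply: wp_imp (wp_reset_a s1) => s2 [F2 a_s2].
  have {}st_s := frame_state F2 isT isT st_s.
  have {}score_s2 : rmem s2 q_score = 0 by rewrite (frame_rmem F2).
  apply: wp_seq; apply: wp_imp
    (wp_sum_rates (ss_inputs st_s) (ss_digits st_s) a_s2 score_s2) => s3 [F3 score_s3].
  have {}st_s := frame_state F3 isT isT st_s.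
  apply: wp_seq; apply: wp_imp (wp_reset_a s3) => s4 [F4 a_s4].
  have {}st_s := frame_state F4 isT isT st_s.
  apply: wp_seq; apply: wp_imp
    (wp_reject_clashes (ss_inputs st_s) (ss_digits st_s) a_s4) => s5 [F5 score_s5].
  have {}st_s := frame_state F5 isT isT st_s.
  apply: wp_seq; apply: wp_imp (wp_reset_a s5) => s6 [F6 a_s6].
  have {}st_s := frame_state F6 isT isT st_s.
  have {}score_s6 : rmem s6 q_score = score x.
    by rewrite (frame_rmem F6) // score_s5 (frame_rmem F4) // score_s3.
  apply: wp_seq; apply: (@wp_imp _ _ _ _ _ _ _ _ (search_state x (best_code x.+1))); last first.
    apply: (@wp_if _ _ _ _ _ _ _ _ _ (h * 20 + 10)) => /=;
      rewrite (ss_score st_s) score_s6 ?negbK -?ltNge => cmp; last first.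
      apply: wp_le (wp_denote _ _) => //; first by rewrite /=; lia.
      by rewrite denoteE ltNge cmp.
    rewrite cmp; eapply wp_le; last first.
      apply: wp_seq; apply: wp_imp (_ : wp _ 1 (fun s' =>
        frame [::] [:: q_best] false false s6 s' /\ rmem s' q_best = score x) s6); last first.
        by apply: wp_frame; [writes | apply: wp_denote; rewrite ?denoteE].
      move=> s7 [F7 score_s7].
      have in_s7 := frame_inputs F7 isT (ss_inputs st_s).
      have dig_s7 := frame_digits F7 isT (ss_digits st_s).
      have a_s7 : nmem s7 v_a = 0%N by rewrite (frame_var F7).
      apply: wp_imp (wp_save_best in_s7 dig_s7 a_s7) => s8 [F8 best_s8].
      split=> //.
      - exact: frame_inputs F8 _ in_s7.
      - exact: frame_digits F8 _ dig_s7.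
      - by rewrite (frame_rmem F8).
      - by rewrite (frame_var F8) // (frame_var F7) // (ss_done st_s).
    lia.
  move=> s7 {}st_s; apply: wp_seq; apply: wp_imp (wp_reset_a s7) => s8 [F8 a_s8].
  have {}st_s := frame_state F8 isT isT st_s.
  apply: wp_seq; apply: wp_imp
    (wp_carry (ss_inputs st_s) (ss_digits st_s) a_s8) => s9 [F9 [i [le_i a_s9 max_i dig_i dig_s9]]].
  apply: wp_denote => //.
  have [half_s9 off_s9 count_s9 list_s9] := frame_inputs F9 isT (ss_inputs st_s).
  rewrite denote_if /= a_s9 half_s9 addn1; case: (ltnP i h) => [lt_i|le_hi].
    rewrite denoteE neval_cell /= neval_cell /= a_s9.
    (* Digit [i] of the successor is positive, whereas the [h] low digits of [B ^ h] vanish. *)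
    have max_x : (x.+1 < B ^ h)%N.
      rewrite ltn_neqAle lt_x andbT; apply/eqP => x_max; have := digitS (ltn0Sn _) max_i (dig_i lt_i) i.
      by rewrite x_max digit_expn // ltnn eqxx.
    rewrite max_x; split=> [|a lt_a|a lt_a||]; eval_state.
    - by split; eval_state => d le_d; eval_state; apply: list_s9.
    - rewrite dig_s9 // ltnn (digitS (ltn0Sn _) max_i (dig_i lt_i)) !dig_s9 // addn1.
      by case: (ltngtP a i).
    - by rewrite (frame_cell F9) // (ss_best st_s).
    - by rewrite (frame_rmem F9) // (ss_score st_s).
    - by rewrite (frame_var F9) // (ss_done st_s).
  have def_i : i = h by apply/eqP; rewrite eqn_leq le_i.
  have max_h a : (a < h)%N -> digit B x a = B.-1 by rewrite -def_i; apply: max_i.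
  rewrite (digitS_overflow (ltn0Sn _) lt_x max_h) ltnn denoteE /=.
  by split=> // a lt_a; eval_state; rewrite (frame_cell F9) // (ss_best st_s).
rewrite /=; nia.
Qed.

Lemma wp_search s : search_state 0 0 s ->
  wp search (B ^ h * ((h * h + 1) * 200)).+1 (fun s' =>
    frame [:: v_a; v_c; v_done; r_digit; r_best] [:: q_score; q_best] false false s s' /\
    forall a, (a < h)%N -> nmem s' (addr r_best a) = digit B (best_code (B ^ h)) a) s.
Proof.
move=> st_s; have wr : writes_within [:: v_a; v_c; v_done; r_digit; r_best]
  [:: q_score; q_best] false false search by writes.
apply: (wp_frame wr).
(* The iteration count is the current code. After the last code only the flag and the stored best
   digits matter. *)
pose I x s' := if (x < B ^ h)%N then search_state x (best_code x) s'
     else (0 < nmem s' v_done)%N /\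
          forall a, (a < h)%N -> nmem s' (addr r_best a) = digit B (best_code x) a.
apply: wp_le (_ : ((B ^ h * ((h * h + 1) * 150).+1).+1 <= _)%N) _; first by nia.
have wr_body : writes_within [:: v_a; v_c; v_done; r_digit; r_best]
  [:: q_score; q_best] false false search_body by writes.
apply: wp_imp (wp_for_frame (I := I) wr_body _ _ _).
- by move=> s' [_]; rewrite /I ltnn => -[].
- move=> x s' _ _; rewrite /I; case: ltnP => lt_x /=; first by case=> _ _ _ _ ->.
  by case; case: nmem.
- by move=> x s' lt_x _; rewrite /I lt_x; apply: wp_search_body.
- by rewrite /I expn_gt0.
Qed.

End RunSearch.

(** * The sale and the complete run *)

Section RunProgram.
Variables (R : realType) (n m : nat) (M : market R n m).
Variables (b : 'I_n -> R) (w : nat -> bool).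
Local Notation wp := (wp M b w).
Local Notation denote := (denote M b w).

Definition sold_to (off h : nat) (g : nat -> nat) (k : nat) : option nat :=
  if (off <= k < off + h)%N then Some (g (k - off)%N) else None.

(** For a real bidder and a clash-free assignment the sum has at most one term, so it agrees with
    the maximum used by [bundle_value]. *)
Definition click_rate (off h : nat) (g : nat -> nat) (i : nat) : R :=
  \sum_(a < h | g a == i) lookup 0 (ctr M) (off + a).

Lemma wp_sell lst off h x p s : let g := holder n lst x in
  (forall a c, (a < h)%N -> (c < h)%N -> g a = g c -> (g a < n)%N -> a = c) ->
  search_inputs n lst off h s -> nmem s v_a = 0%N ->
  rmem s q_price = p -> (forall k, owner s k = None) -> (forall i, payment s i = 0) ->
  (forall a, (a < h)%N -> nmem s (addr r_best a) = digit (size lst).+1 x a) ->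
  wp sell_slots (h * 20).+1 (fun s' =>
    (forall k, owner s' k = sold_to off h g k) /\
    (forall i, (i < n)%N -> payment s' i = p * click_rate off h g i)) s.
Proof.
move=> g g_inj [half_s off_s count_s list_s] a0 price_s owner0 payment0 best_s.
have : wp sell_slots (h * 20).+1 (fun s' =>
    frame [:: v_a] [::] false true s s' /\
    [/\ nmem s' v_a = h, forall k, owner s' k = sold_to off h g k &
    forall i, (i < n)%N -> payment s' i = p * click_rate off h g i]) s.
  apply: (@wp_for_frame _ _ _ _ _ _ _ _ _ _ _ _ _ _ (fun i s' =>
    [/\ nmem s' v_a = i, forall k, owner s' k = sold_to off i g k &
    forall j, (j < n)%N -> payment s' j = p * click_rate off i g j])).
  - writes.
  - by move=> i s' _ F [a_i _ _]; rewrite /= a_i (frame_var F) // half_s addn1.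
  - move=> i s' lt_i F [a_i owner_i payment_i].
    have off_s' : nmem s' v_off = off by rewrite (frame_var F).
    have price_s' : rmem s' q_price = p by rewrite (frame_rmem F).
    have best_i : nmem s' (addr r_list (nmem s' (addr r_best i))) = g i.
      rewrite [nmem _ (addr r_best _)](frame_cell F) // best_s // (frame_cell F) //.
      by rewrite list_s // -ltnS ltn_mod.
    apply: wp_le (wp_denote _ _) => //.
    rewrite !denote_seq !denoteE; eval_state; rewrite !neval_cell /= a_i best_i off_s' price_s' addn1.
    split=> // [k|j lt_j].
      rewrite owner_i /sold_to; case: eqVneq => [->|neq_k].
        by rewrite leq_addr ltn_add2l ltnSn addKn.
      by congr (if _ then _ else _); lia.
    rewrite payment_i // /click_rate [in RHS]big_mkcond big_ord_recr -big_mkcond /=.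
    (* A new charge replaces the old one instead of adding to it; for the bidder charged now,
       injectivity of [g] makes the earlier partial sum empty. *)
    case: eqVneq => [eq_j|neq_j]; rewrite ?addr0 // big1 ?add0r // => a /eqP g_a.
    have := g_inj a i (ltn_trans (ltn_ord a) lt_i) lt_i.
    rewrite g_a eq_j => /(_ erefl); rewrite -eq_j => /(_ lt_j) def_a.
    by have := ltn_ord a; rewrite def_a ltnn.
  - split=> // [k|j lt_j]; first by rewrite owner0 /sold_to; case: ifP => //; lia.
    by rewrite payment0 /click_rate big_ord0 mulr0.
by apply: wp_imp => s' [F [_ ? ?]].
Qed.

Lemma holder_inj lst off h x : uniq lst -> n \notin lst ->
  clashing M lst off h x = false ->
  forall a c, (a < h)%N -> (c < h)%N ->
    holder n lst x a = holder n lst x c -> (holder n lst x a < n)%N -> a = c.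
Proof.
move=> uniq_lst n_lst no_clash a c lt_a lt_c eq_h lt_h; apply/eqP.
apply: contraFT no_clash => neq_ac; apply/hasP; exists a; first by rewrite mem_iota.
apply/hasP; exists c; first by rewrite mem_iota.
have dig_lt d : (digit (size lst).+1 x d < size (n :: lst))%N by rewrite /= ltn_mod.
have/eqP eq_d : digit (size lst).+1 x a == digit (size lst).+1 x c.
  by rewrite -(nth_uniq n (dig_lt a) (dig_lt c)) /= ?n_lst //; apply/eqP.
rewrite /clash neq_ac eq_d eqxx /=; case: eqP => // dig0.
by move: lt_h; rewrite eq_h /holder dig0 ltnn.
Qed.

Definition winners_list : seq nat := shortlist M (uphalf m) (eligible M b w).

Definition winner (a : nat) : nat :=
  let off := block_offset m w in let h := uphalf m in
  holder n winners_list
    (best_code M winners_list off h ((size winners_list).+1 ^ h)) a.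

Definition run_time : nat :=
  (n * 60 + uphalf m * 50 + threshold_coins m * 20 +
   (size winners_list).+1 ^ uphalf m * ((uphalf m * uphalf m + 1) * 200) + 100)%N.

Lemma wp_program : wp program run_time (fun s =>
    (forall k, owner s k = sold_to (block_offset m w) (uphalf m) winner k) /\
    (forall i, (i < n)%N ->
       payment s i = price M b w * click_rate (block_offset m w) (uphalf m) winner i))
  (init_state R).
Proof.
eapply wp_le; last first.
  apply: wp_seq; apply: wp_denote => //; apply: wp_seq; apply: wp_denote => //.
  rewrite !denoteE /=; set s1 := State _ _ _ _ _.
  have zero1 r i : (r < 16)%N -> r \notin [:: v_off; v_type] -> nmem s1 (addr r i) = 0%N.
    by move=> lt_r; rewrite /s1; eval_state; rewrite !inE negb_or => /andP[/negPf-> /negPf->].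
  have [off1 type1] : nmem s1 v_off = w 0%N /\ nmem s1 v_type = w 1%N by [].
  apply: wp_seq.
  apply: wp_imp (@wp_sample _ _ _ M b w s1 _ _ _ _ _) => // s2 [F2 [coins2 deg2 sampled2 price2]].
  apply: wp_seq; apply: wp_imp (@wp_count _ _ _ M b w s2 _ _ deg2 _); first last.
  - by rewrite (frame_rmem F2).
  - by rewrite (frame_var F2).
  - by rewrite (frame_var F2).
  move=> s3 [F3 [half3 cap3 slots3]].
  have off3 : nmem s3 v_off = w 0%N by rewrite (frame_var F3) // (frame_var F2).
  apply: wp_seq; apply: wp_imp (_ : wp choose_block _ (fun s4 =>
    frame [:: v_off] [::] false false s3 s4 /\ nmem s4 v_off = block_offset m w) s3); last first.
    apply: wp_frame; first by writes.
    apply: wp_denote => //; rewrite denote_if /= off3 lt0b /block_offset.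
    by move: off3; case: (w 0) => off3; rewrite denoteE /= ?half3 ?off3.
  move=> s4 [F4 off4].
  apply: wp_seq; apply: wp_imp (_ : wp _ 1 (fun s5 =>
    frame [::] [:: q_factor] false false s4 s5 /\ rmem s5 q_factor = 2) s4); last first.
    by apply: wp_frame; [writes | apply: wp_denote; rewrite ?denoteE].
  move=> s5 [F5 factor5].
  apply: wp_seq; apply: wp_imp (@wp_lower _ _ _ M b w s5 _ _ factor5 _); first last.
  - by rewrite (frame_rmem F5) // (frame_rmem F4).
  - by rewrite (frame_rmem F5) // (frame_rmem F4) // (frame_rmem F3) // price2.
  - by rewrite (frame_coins F5) // (frame_coins F4) // (frame_coins F3).
  move=> s6 [F6 price6].
  apply: wp_seq; apply: wp_imp (_ : wp _ 1 (fun s7 =>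
    frame [:: v_i] [::] false false s6 s7 /\ nmem s7 v_i = 0%N) s6); last first.
    by apply: wp_frame; [writes | apply: wp_denote; rewrite ?denoteE].
  move=> s7 [F7 i7].
  apply: wp_seq; apply: wp_imp (_ : wp _ 1 (fun s8 =>
    frame [:: r_list] [::] false false s7 s8 /\ nmem s8 (addr r_list 0) = n) s7); last first.
    by apply: wp_frame; [writes | apply: wp_denote => //; rewrite denoteE; eval_state; rewrite eqxx].
  move=> s8 [F8 list8].
  (* The regions outside this list are still at their initial zeros, so the list counter and the
     done flag are 0 and the search starts at code 0. *)
  have thru r i : (r < 16)%N -> r \notin [:: v_off; v_type; v_i; v_deg; v_half; v_cap; v_bit; r_list; r_sampled] ->
    nmem s8 (addr r i) = 0%N.
    move=> lt_r; rewrite !inE !negb_or => /and5P[r4 r5 r0 r1 /and5P[r2 r3 r9 r12 r11]].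
    rewrite (frame_cell F8) ?inE // (frame_cell F7) ?inE // (frame_cell F6) ?inE //.
    rewrite (frame_cell F5) // (frame_cell F4) ?inE // (frame_cell F3) ?inE ?negb_or ?r2 //.
    by rewrite (frame_cell F2) ?inE ?negb_or ?r0 ?r1 // zero1 // !inE negb_or r4.
  have price8 : rmem s8 q_price = price M b w by rewrite (frame_rmem F8) // (frame_rmem F7).
  apply: wp_seq; apply: wp_imp (@wp_select _ _ _ M b w s8 _ _ _ _ _ price8 list8); first last.
  - move=> j lt_j; rewrite (frame_cell F8) // (frame_cell F7) // (frame_cell F6) // (frame_cell F5) //.
    by rewrite (frame_cell F4) // (frame_cell F3) // sampled2.
  - rewrite (frame_var F8) // (frame_var F7) // (frame_var F6) // (frame_var F5) //.
    by rewrite (frame_var F4) // (frame_var F3) // (frame_var F2).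
  - by rewrite (frame_var F8) // (frame_var F7) // (frame_var F6) // (frame_var F5) // (frame_var F4).
  - exact: (thru v_count 0%N).
  - by rewrite (frame_var F8).
  move=> s9 [F9 [count9 list9]].
  have st9 : search_state M winners_list (block_offset m w) (uphalf m) 0 0 s9.
    split.
    - split=> //.
      + rewrite (frame_var F9) // (frame_var F8) // (frame_var F7) // (frame_var F6) //.
        by rewrite (frame_var F5) // (frame_var F4).
      + rewrite (frame_var F9) // (frame_var F8) // (frame_var F7) // (frame_var F6) //.
        by rewrite (frame_var F5).
    - by move=> a lt_a; rewrite (frame_cell F9) // thru // digit0.
    - by move=> a lt_a; rewrite (frame_cell F9) // thru // digit0.
    - rewrite (frame_rmem F9) // (frame_rmem F8) // (frame_rmem F7) // (frame_rmem F6) //.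
      rewrite (frame_rmem F5) // (frame_rmem F4) // (frame_rmem F3) // (frame_rmem F2) //.
      rewrite /score; case: ifP => // _; rewrite big_pred0 // => a.
      by rewrite digit0.
    - by rewrite (frame_var F9) // (thru v_done 0%N).
  apply: wp_seq; apply: wp_imp (wp_search b w st9) => s10 [F10 best10].
  apply: wp_seq; apply: wp_imp (wp_reset_a M b w s10) => s11 [F11 a11].
  apply: wp_sell => //.
  - apply: holder_inj; [exact: shortlist_uniq | exact: notin_shortlist | exact: clashing_best].
  - apply: frame_inputs F11 _ _ => //; apply: frame_inputs F10 _ _ => //.
    by case: st9.
  - by rewrite (frame_rmem F11) // (frame_rmem F10) // (frame_rmem F9).
  - move=> k; rewrite (frame_owner F11) // (frame_owner F10) // (frame_owner F9) //.
    rewrite (frame_owner F8) // (frame_owner F7) // (frame_owner F6) // (frame_owner F5) //.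
    by rewrite (frame_owner F4) // (frame_owner F3) // (frame_owner F2).
  - move=> k; rewrite (frame_payment F11) // (frame_payment F10) // (frame_payment F9) //.
    rewrite (frame_payment F8) // (frame_payment F7) // (frame_payment F6) // (frame_payment F5) //.
    by rewrite (frame_payment F4) // (frame_payment F3) // (frame_payment F2).
  - by move=> a lt_a; rewrite (frame_cell F11) // best10.
rewrite /run_time /=; lia.
Qed.

End RunProgram.

(** * Running time and truthfulness *)

Section RunningTime.

(** Using half of the slots pays here. With [Y = h (D + 1)] there are at most [(2 Y) ^ h] codes,
    while [m >= 2 h - 1] leaves a spare factor [Y ^ (h - 1)] in the target, which absorbs [2 ^ h]
    and the quadratic cost of one code. *)
Lemma leq_expn_half (D m : nat) :
  ((uphalf m * D.*2.+1).+1 ^ uphalf m * (uphalf m * uphalf m + 1) <=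
   16 * (m * (D + 1)) ^ m)%N.
Proof.
set h := uphalf m; set X := (m * (D + 1))%N.
have [m0|m_gt0] := posnP m; first by rewrite /X /h m0.
have h_gt0 : (0 < h)%N by rewrite /h; lia.
pose Y := (h * (D + 1))%N.
have le_hY : (h <= Y)%N by rewrite /Y leq_pmulr // addn1.
have le_YX : (Y <= X)%N by rewrite /Y /X leq_mul2r /h; lia.
have le_exp : (Y ^ h * Y ^ h.-1 <= X ^ m)%N.
  rewrite -expnD; apply: (@leq_trans (X ^ (h + h.-1))); first by rewrite leq_exp2r //; lia.
  by apply: leq_pexp2l; rewrite /h; lia.
apply: (@leq_trans ((2 * Y) ^ h * (2 * (h * h)))).
  by apply: leq_mul; [rewrite leq_exp2r // /Y; nia | nia].
rewrite expnMn; apply: leq_trans (leq_mul (leqnn 16) le_exp).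
suff: (2 ^ h * (h * h) <= 8 * Y ^ h.-1)%N by move/(leq_mul (leqnn (2 * Y ^ h))); nia.
apply: (@leq_trans (8 * h ^ h.-1)); last first.
  by rewrite leq_mul2l; case: (h.-1) => [//|k]; rewrite leq_exp2r.
(* For [h = k + 3] the claim reduces to [2 ^ k <= (k + 3) ^ k]; the constant 8 is sharp, with
   equality at [h = 2]. *)
move: (h) h_gt0 => [|[|[|k]]] // _ /=.
rewrite !expnS; have : (2 ^ k <= k.+3 ^ k)%N by case: k => // k; rewrite leq_exp2r.
move: (2 ^ k)%N (k.+3 ^ k)%N => u v; nia.
Qed.

End RunningTime.

(** * Outcome, utility and truthfulness *)

Section Mechanism.
Variables (R : realType) (n m : nat) (M : market R n m).

Local Notation h := (uphalf m).
Local Notation off w := (block_offset m w).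

Lemma threshold_coins_le : (threshold_coins m <= h)%N.
Proof.
rewrite /threshold_coins; case: ex_minnP => q _ /(_ h); apply.
case: (h) => // k; rewrite expnS; have lt_k : (k < 2 ^ k)%N by apply: ltn_expl.
by apply: leq_trans (ltnW (ltn_expl _ (ltnSn 1))); lia.
Qed.

(** The search accounts for [200 * 16] of the constant 4000; the rest covers the linear terms, as
    both [h] and [q] are at most the power on the right. *)
Lemma run_time_le (b : 'I_n -> R) w (D := max_outdeg M) :
  (run_time M b w <= 40 * 100 * (n + (m * (D + 1)) ^ m))%N.
Proof.
rewrite /run_time.
have X_gt0 : (0 < (m * (D + 1)) ^ m)%N.
  by case: (m) => // k; rewrite expn_gt0 muln_gt0 addn1.
have le_hX : (h <= (m * (D + 1)) ^ m)%N.
  apply: (@leq_trans m); first lia.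
  case: (m) => // k; rewrite expnS -mulnA leq_pmulr // muln_gt0 addn1 /=.
  by rewrite expn_gt0 muln_gt0.
have le_q := threshold_coins_le.
have le_list : (size (winners_list M b w) <= h * D.*2.+1)%N.
  by rewrite size_take; case: ltnP => // /ltnW.
have := leq_expn_half D m.
have : ((size (winners_list M b w)).+1 ^ h * (h * h + 1) <=
   (h * D.*2.+1).+1 ^ h * (h * h + 1))%N.
  by rewrite leq_mul2r; case: (h) le_list => // k ?; rewrite leq_exp2r // ltnS ?orbT.
rewrite [(_ * (_ * 200))%N]mulnA.
move: ((size _).+1 ^ h * _)%N ((h * D.*2.+1).+1 ^ h * _)%N ((m * (D + 1)) ^ m)%N X_gt0 le_hX.
by move=> u v X X_gt0 le_hX le_uv le_vX; lia.
Qed.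

Lemma block_fits w : (off w + h <= m)%N.
Proof. rewrite /block_offset; case: (w 0); lia. Qed.

Lemma click_rate_ge0 o (g : nat -> nat) i : 0 <= click_rate M o h g i.
Proof. by apply: sumr_ge0 => a _; apply: rate_ge0. Qed.

Lemma winner_mem b w a : winner M b w a \in n :: winners_list M b w.
Proof. by apply: mem_nth; rewrite /= ltn_mod. Qed.

Lemma click_rate_loser b w i : (i < n)%N -> ~~ eligible M b w i ->
  click_rate M (off w) h (winner M b w) i = 0.
Proof.
move=> lt_i nelig; rewrite /click_rate big_pred0 // => a; apply/eqP => def_i.
have := winner_mem b w a; rewrite def_i inE => /predU1P[eq_i|].
  by rewrite eq_i ltnn in lt_i.
by move/mem_shortlist => /andP[]; rewrite (negPf nelig).
Qed.

Section Outcome.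
Variables (b : 'I_n -> R) (w : nat -> bool) (s : state R).
Hypothesis owner_s : forall k, owner s k = sold_to (off w) h (winner M b w) k.

(** A real bidder holds at most one slot, and never a conflicted one, so the maximum has at most one
    term. Here [x] is any value, not necessarily the report, as truthfulness requires. *)
Lemma conflict_value_output (i : 'I_n) x : 0 <= x ->
  conflict_value M x (output n m s).1 i =
  x * click_rate M (off w) h (winner M b w) i.
Proof.
move=> x_ge0; set g := winner M b w.
have in_S (j : 'I_n) (k : 'I_m) : (k \in (output n m s).1 j) =
    (off w <= k < off w + h)%N && (g (k - off w)%N == j).
  by rewrite !ffunE inE owner_s /sold_to; case: ifP.
rewrite /conflict_value /bundle_value /click_rate.
have [/existsP[a /eqP g_a]|no_a] := boolP [exists a : 'I_h, g a == i]; last first.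
  rewrite !big_pred0 ?mulr0 // => [a|k].
    by apply: contraNF no_a => g_a; apply/existsP; exists a.
  rewrite !inE in_S; apply: contraNF no_a => /and3P[_ /andP[le_k lt_k] g_k].
  have lt_h : (k - off w < h)%N by lia.
  by apply/existsP; exists (Ordinal lt_h).
have g_inj := holder_inj (shortlist_uniq _ _ _) (notin_shortlist _ _ _)
  (clashing_best M (winners_list M b w) (off w) h ((size (winners_list M b w)).+1 ^ h)).
have inj_a (c : nat) : (c < h)%N -> g c = i -> c = a.
  move=> lt_c g_c; apply: (g_inj c a lt_c (ltn_ord a)); first exact: etrans g_c (esym g_a).
  by rewrite -[X in (X < _)%N]/(g c) g_c.
have lt_m : (off w + a < m)%N by have := block_fits w; have := ltn_ord a; lia.
pose k0 := Ordinal lt_m.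
have k0E (k : 'I_m) : (off w <= k < off w + h)%N && (g (k - off w)%N == i) = (k == k0).
  apply/andP/eqP => [[/andP[le_k lt_k] /eqP g_k]|->].
    by apply: val_inj; rewrite /= -(inj_a (k - off w)%N) ?subnKC //; lia.
  by rewrite /= leq_addr ltn_add2l ltn_ord addKn g_a eqxx.
rewrite [in RHS](big_pred1 a) => [|c]; last first.
  apply/eqP/eqP => [g_c|->]; [apply: val_inj; exact: (inj_a c (ltn_ord c) g_c) | exact: g_a].
rewrite (lookup_ord 0 (ctr M) k0).
(* No slot is lost to a conflict, as this would be a clash in the best code. *)
rewrite (eq_bigl (pred1 k0)) => [|k]; last first.
  rewrite inE in_S k0E [k \in conflicted _ _ _]inE in_S k0E /=.
  case: eqVneq => //= ->; rewrite andbT; apply/existsP => -[j /existsP[l]].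
  rewrite in_S => /and3P[/andP[/andP[le_l lt_l] /eqP g_l] conf_ij conf_kl].
  have := clashing_best M (winners_list M b w) (off w) h ((size (winners_list M b w)).+1 ^ h).
  move/negbT/negP; apply; apply/hasP; exists (a : nat); first by rewrite mem_iota add0n /=.
  apply/hasP; exists (l - off w)%N; first by rewrite mem_iota add0n /=; lia.
  rewrite /clash -[holder _ _ _ a]/(g a) -[holder _ _ _ (l - _)]/(g _) g_a g_l lookup2_ord conf_ij.
  by rewrite subnKC // (lookup2_ord _ k0 l) conf_kl orbT.
rewrite big_pred1_eq_id; apply/max_idPl; rewrite mulr_ge0 //; exact: ctr_ge0.
Qed.

End Outcome.

Definition mechanism : rand_mechanism R n m :=
  computed_mechanism M program (40 * 100 * (n + (m * (max_outdeg M + 1)) ^ m)).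

Lemma run_program b w :
  let cf := run M program b w (40 * 100 * (n + (m * (max_outdeg M + 1)) ^ m)) in
  [/\ cf.1 = [::], forall k, owner cf.2 k = sold_to (off w) h (winner M b w) k &
   forall i, (i < n)%N ->
     payment cf.2 i = price M b w * click_rate M (off w) h (winner M b w) i].
Proof.
by have [? []] := wp_run (wp_program M b w) (run_time_le b w).
Qed.

Lemma mechanism_utility b w (i : 'I_n) x : 0 <= x ->
  utility M x i (mechanism w b) =
  (x - price M b w) * click_rate M (off w) h (winner M b w) i.
Proof.
move=> x_ge0; have [_ owner_s payment_s] := run_program b w.
by rewrite /utility (conflict_value_output owner_s) // /= payment_s // mulrBl.
Qed.

Lemma mechanism_welfare v w : nonneg_profile v ->
  social_welfare M v (mechanism w v).1 =
  \sum_(i < n) v i * click_rate M (off w) h (winner M v w) i.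
Proof.
move=> v_ge0; have [_ owner_s _] := run_program v w.
by apply: eq_bigr => i _; rewrite (conflict_value_output owner_s).
Qed.

Lemma sample_max_ext (b b' : 'I_n -> R) w k :
  (forall j, w (2 + j)%N && type_ok M w j -> lookup 0 b j = lookup 0 b' j) ->
  sample_max M b w k = sample_max M b' w k.
Proof.
by move=> eq_b; elim: k => //= k ->; case: ifP => // /eq_b->.
Qed.

Lemma price_ext (b b' : 'I_n -> R) w :
  (forall j, w (2 + j)%N && type_ok M w j -> lookup 0 b j = lookup 0 b' j) ->
  price M b w = price M b' w.
Proof.
move=> eq_b; rewrite /price; elim: (threshold_coins m) => /= [|k ->//].
exact: sample_max_ext.
Qed.

Lemma winner_ext (b b' : 'I_n -> R) w :
  eligible M b w =1 eligible M b' w -> winner M b w =1 winner M b' w.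
Proof.
by move=> eq_elig a; rewrite /winner /winners_list /shortlist (eq_filter eq_elig).
Qed.

Lemma mechanism_truthful : universally_truthful M mechanism.
Proof.
move=> w b i x b_ge0 x_ge0; rewrite !mechanism_utility //.
pose b' : 'I_n -> R := [eta b with i |-> x]; rewrite -/b'.
have b'_i : lookup 0 b' i = x by rewrite lookup_ord /b' /= eqxx.
have b'_neq (j : nat) : j != i -> lookup 0 b' j = lookup 0 b j.
  move=> neq_j; rewrite /lookup; case: insubP => //= j' _ def_j.
  by rewrite /b' /= -val_eqE /= def_j (negPf neq_j).
(* A bidder who is sampled or of the wrong type is ineligible whatever the report, with utility
   0. *)
have [|sees_i] := boolP (w (2 + i)%N || ~~ type_ok M w i).
  move=> blind; rewrite !click_rate_loser ?mulr0 //; rewrite /eligible.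
    by case: (w _) blind => //= /negPf->; rewrite andbF.
  by case: (w _) blind => //= /negPf->; rewrite andbF.
move: sees_i; rewrite negb_or negbK => /andP[/negPf w_i type_i].
have eq_p : price M b w = price M b' w.
  apply: price_ext => j; case: (eqVneq j i) => [->|neq_j]; first by rewrite w_i.
  by rewrite b'_neq.
have elig_neq (j : nat) : j != i -> eligible M b w j = eligible M b' w j.
  by move=> neq_j; rewrite /eligible -eq_p b'_neq.
have elig_i : eligible M b' w i = (price M b w < x).
  by rewrite /eligible w_i type_i -eq_p b'_i andbT.
have [eq_i|neq_i] := eqVneq (eligible M b w i) (eligible M b' w i).
  have eq_elig : eligible M b w =1 eligible M b' w.
    by move=> j; have [->//|/elig_neq] := eqVneq j i.
  rewrite -eq_p /click_rate; under eq_bigl do rewrite (winner_ext eq_elig).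
  exact: lexx.
(* The lie changes eligibility. With a true value above the price it forfeits a nonnegative utility;
   otherwise it can only buy at a price of at least the value. *)
rewrite -eq_p; have [lt_px|le_xp] := ltP (price M b w) x.
  have nelig : ~~ eligible M b w i by move: neq_i; rewrite elig_i lt_px; case: eligible.
  by rewrite click_rate_loser // mulr0 mulr_ge0 ?click_rate_ge0 // subr_ge0 ltW.
rewrite [in leRHS]click_rate_loser // ?elig_i -?leNgt // mulr0.
by rewrite mulr_le0_ge0 ?click_rate_ge0 // subr_le0.
Qed.

End Mechanism.

(** * Expectation over coins *)

Section Coins.
Variable T : nat.

Definition matches (f : nat -> bool) (ps : seq nat) (w : nat -> bool) : bool :=
  all (fun p => w p == f p) ps.

(** Flipping coin [p] maps the sequences that match on [ps] but not at [p] injectively into those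
    that match everywhere. Equality may fail, as positions may repeat. *)
Lemma card_matches f ps : all (fun p => p < T)%N ps ->
  (2 ^ T <= #|[set w : T.-tuple bool | matches f ps (nth false w)]| * 2 ^ size ps)%N.
Proof.
elim: ps => [_|p ps IH /= /andP[lt_p /IH{IH}/leq_trans-> //]].
  by rewrite muln1 (_ : [set w | _] = [set: T.-tuple bool]) ?cardsT ?card_tuple ?card_bool //.
set A := [set w : T.-tuple bool | matches f ps (nth false w)].
set A1 := [set w : T.-tuple bool | matches f (p :: ps) (nth false w)].
rewrite expnS mulnCA mulnA leq_mul2r; apply/orP; right.
pose flip (w : T.-tuple bool) := [tuple tnth w i (+) (i == Ordinal lt_p) | i < T].
have flipK : involutive flip.
  move=> w; apply: eq_from_tnth => i; rewrite !tnth_mktuple.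
  by rewrite -addbA addbb addbF.
have nth_flip w i : nth false (flip w) i = nth false w i (+) (i == p).
  have [lt_i|le_i] := ltnP i T.
    by rewrite -[i]/(val (Ordinal lt_i)) -!tnth_nth tnth_mktuple.
  by rewrite !nth_default ?size_tuple //; case: eqP => // eq_ip; have := lt_p; rewrite -eq_ip ltnNge le_i.
have sA1 : A1 \subset A by apply/subsetP => w; rewrite !inE => /andP[].
rewrite -(cardsID A1 A) mul2n -addnn (setIidPr sA1) leq_add2l.
rewrite -(card_imset _ (inv_inj flipK)); apply/subset_leq_card/subsetP => w' /imsetP[w w_A ->{w'}].
move: w_A; rewrite !inE /= -!/(matches _ _ _) => /andP[/nandP[neq_p|/negPf->//] match_w].
rewrite nth_flip eqxx addbT; apply/andP; split; first by case: nth neq_p; case: (f p).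
apply/allP => r ps_r; rewrite nth_flip; have /eqP w_r := allP match_w r ps_r.
by case: (eqVneq r p) => [eq_r|_]; [rewrite -eq_r w_r eqxx in neq_p | rewrite addbF w_r].
Qed.

End Coins.

Section Expectation.
Variable R : realType.

Lemma expect_ge0 T (X : (nat -> bool) -> R) : (forall w, 0 <= X w) -> 0 <= expect T X.
Proof.
move=> X_ge0; rewrite /expect mulr_ge0 ?invr_ge0 ?exprn_ge0 //.
by apply: sumr_ge0.
Qed.

(* Every term x i is collected with probability at least 2^-k. *)
Lemma expect_ge_sum T k (X : (nat -> bool) -> R) (I : finType) (P : pred I)
    (x : I -> R) (f : I -> nat -> bool) (ps : I -> seq nat) :
  (forall i, P i -> 0 <= x i) ->
  (forall i, P i -> all (fun p => p < T)%N (ps i) /\ size (ps i) = k) ->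
  (forall w, \sum_(i | P i && matches (f i) (ps i) w) x i <= X w) ->
  \sum_(i | P i) x i <= 2 ^+ k * expect T X.
Proof.
move=> x_ge0 ps_ok X_ge; rewrite /expect mulrA ler_pdivlMr ?exprn_gt0 //.
apply: (@le_trans _ _ (2 ^+ k * \sum_(w : T.-tuple bool)
    \sum_(i | P i) if matches (f i) (ps i) (nth false w) then x i else 0)); last first.
  by rewrite ler_wpM2l ?exprn_ge0 //; apply: ler_sum => w _; rewrite -big_mkcondr; apply: X_ge.
rewrite exchange_big /= mulr_suml mulr_sumr; apply: ler_sum => i Pi.
have [ps_T size_ps] := ps_ok i Pi; have := card_matches (f i) ps_T.
rewrite -big_mkcond sumr_const /= size_ps -(ler_nat R) natrM !natrX => le_card.
rewrite -[x i *+ _]mulr_natl mulrA mulrC ler_wpM2r ?x_ge0 //.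
apply: le_trans le_card _; rewrite mulrC ler_wpM2l ?exprn_ge0 // ler_nat.
by apply/subset_leq_card/subsetP => w; rewrite inE.
Qed.

End Expectation.

(** * Approximation *)

Section Approximation.
Variables (R : realType) (n m : nat) (M : market R n m).
Variable v : 'I_n -> R.
Hypothesis v_ge0 : nonneg_profile v.
Implicit Type w : nat -> bool.

Local Notation h := (uphalf m).
Local Notation q := (threshold_coins m).
Local Notation welfare w := (social_welfare M v (mechanism M w v).1).

(** Each bidder with an unconflicted slot keeps a best one of these. Dropping slots creates no
    conflict, and the value of a bundle is that of its best slot. The slot [k0] only makes [slot]
    total. *)
Lemma allocation_matching (S : bundles n m) (k0 : 'I_m) : is_allocation S ->
  exists (W : {set 'I_n}) (slot : 'I_n -> 'I_m),
  [/\ {in W &, injective slot},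
      {in W &, forall i j, ~~ (conflict M i j && slot_conflict M (slot i) (slot j))} &
      social_welfare M v S <= \sum_(i in W) v i * ctr M (slot i)].
Proof.
move=> allocS; pose A i := S i :\: conflicted M S i.
pose slot i := [arg max_(k > odflt k0 [pick k in A i] | k \in A i) ctr M k]%O.
pose W := [set i | A i != set0].
have slotP i : i \in W -> slot i \in A i /\ forall k, k \in A i -> ctr M k <= ctr M (slot i).
  rewrite inE => /set0Pn[k Ak]; rewrite /slot.
  have Ai : odflt k0 [pick k in A i] \in A i by case: pickP => [//|/(_ k)]; rewrite Ak.
  by case: arg_maxP.
exists W, slot; split.
- move=> i j /slotP[+ _] /slotP[+ _]; rewrite !inE => /andP[_ Si] /andP[_ Sj] eq_slot.
  apply/eqP; move/forallP/(_ i)/forallP/(_ j)/implyP: allocS => disj.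
  apply: contraT => /disj; rewrite -setI_eq0 => /eqP/setP/(_ (slot i)).
  by rewrite !inE Si eq_slot Sj.
- move=> i j /slotP[+ _] /slotP[+ _]; rewrite [slot i \in _]inE => /andP[nconf Si].
  rewrite [slot j \in _]inE => /andP[_ Sj]; apply: contra nconf => conf.
  by rewrite inE Si; apply/existsP; exists j; apply/existsP; exists (slot j); rewrite Sj.
rewrite /social_welfare [leRHS]big_mkcond; apply: ler_sum => i _.
rewrite /conflict_value /bundle_value -/(A i).
have [Wi|] := boolP (i \in W).
  apply: bigmax_le => [|k Ak]; first by rewrite mulr_ge0 // ctr_ge0.
  by rewrite ler_wpM2l //; have [_ ->] := slotP i Wi.
by rewrite inE negbK => /eqP->; rewrite big_set0.
Qed.

(** The winners may differ from [W], so their values are bounded below by a common [u], while the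
    search secures at least the total rate of [W]. *)
Lemma mechanism_welfare_ge w (u : R) (W : {set 'I_n}) (slot : 'I_n -> 'I_m) :
  0 <= u -> (forall i : 'I_n, eligible M v w i -> u <= v i) ->
  {in W, forall i : 'I_n, eligible M v w i} ->
  {in W &, injective slot} ->
  {in W, forall i, w 0%N = (h <= slot i)%N} ->
  {in W &, forall i j, ~~ (conflict M i j && slot_conflict M (slot i) (slot j))} ->
  u * (\sum_(i in W) ctr M (slot i)) <= welfare w.
Proof.
move=> u_ge0 u_le W_elig slot_inj slot_block W_ok; rewrite mechanism_welfare //.
set off := block_offset m w; set lst := winners_list M v w; set g := winner M v w.
have elig_type i : eligible M v w i -> lookup2 (conflict M) i i = w 1%N.
  by case/and3P => _ _ /eqP.
have slot_off : {in W, forall i, off <= slot i < off + h}%N.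
  move=> i /slot_block; rewrite /off /block_offset => ->; have := ltn_ord (slot i).
  by case: (leqP h (slot i)) => ? ? /=; lia.
have opt := shortlist_optimal elig_type W_elig slot_inj slot_off W_ok.
apply: le_trans (ler_wpM2l u_ge0 opt) _.
rewrite /score clashing_best.
apply: (@le_trans _ _ (\sum_(i < n) u * click_rate M off h g i)); last first.
  apply: ler_sum => i _; have [elig_i|nelig] := boolP (eligible M v w i).
    by rewrite ler_wpM2r ?click_rate_ge0 ?u_le.
  by rewrite click_rate_loser // !mulr0.
rewrite -mulr_sumr ler_wpM2l // /click_rate.
rewrite (exchange_big_dep (fun a : 'I_h => g a != n)) /=; last first.
  by move=> i a _ /eqP->; rewrite neq_ltn ltn_ord.
rewrite big_mkcond [leRHS]big_mkcond; apply: ler_sum => a _ /=.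
have g_mem := winner_mem M v w a; rewrite -/g inE in g_mem.
(* As [n] is not in the list, a nonzero digit always denotes a real bidder, so no counted rate is
   lost. *)
have [eq_g|neq_g] /= := eqVneq (g a) n.
  rewrite ifF //; apply/negP => dig_a; have := notin_shortlist M h (eligible M v w).
  rewrite -[X in X \notin _]eq_g /g /winner /holder.
  case: (digit _ _ _) dig_a (ltn_digit (ltn0Sn (size lst)) (best_code M lst off h ((size lst).+1 ^ h)) a) => // d _ lt_d.
  by rewrite /= mem_nth.
rewrite (negPf neq_g) /= in g_mem.
have /mem_shortlist/andP[_ lt_g] := g_mem.
rewrite (big_pred1 (Ordinal lt_g)) => [|i]; last by rewrite /= eq_sym.
by case: ifP => // _; apply: rate_ge0.
Qed.

Lemma sample_max_ge0 w k : 0 <= sample_max M v w k.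
Proof. by elim: k => //= k IH; case: ifP => // _; rewrite le_max IH. Qed.

Lemma sample_max_ge w (i : 'I_n) : w (2 + i)%N -> type_ok M w i ->
  v i <= sample_max M v w n.
Proof.
move=> w_i type_i; suff H k : (i < k)%N -> v i <= sample_max M v w k by apply: H.
elim: k => // k IH; rewrite ltnS leq_eqVlt /=.
case/predU1P => [<-|/IH le_i]; first by rewrite w_i type_i lookup_ord le_max lexx orbT.
by case: ifP => // _; rewrite le_max le_i.
Qed.

Lemma sample_max_le w u : 0 <= u ->
  (forall i : 'I_n, w (2 + i)%N -> type_ok M w i -> v i <= u) ->
  sample_max M v w n <= u.
Proof.
move=> u_ge0 v_le; suff H k : (k <= n)%N -> sample_max M v w k <= u by apply: H.
elim: k => //= k IH lt_k.
case: ifP => [/andP[w_k type_k]|_]; last by apply: IH; apply: ltnW.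
rewrite ge_max IH 1?ltnW //= -[k]/(val (Ordinal lt_k)) lookup_ord.
exact: v_le.
Qed.

Lemma price_bits w t : (t < 2 ^ q)%N ->
  (forall j, (j < q)%N -> w (2 + n + j)%N = (digit 2 t j == 1%N)) ->
  price M v w = sample_max M v w n / 2 ^+ t.
Proof.
move=> lt_t bits; rewrite -[in RHS](bits_sum lt_t) /price.
suff H k : (k <= q)%N -> price_after M v w k =
    sample_max M v w n / 2 ^+ (\sum_(j < k | digit 2 t j == 1%N) 2 ^ j) by apply: H.
elim: k => [|k IH] lt_k /=; first by rewrite big_ord0 divr1.
rewrite [in RHS]big_mkcond big_ord_recr -big_mkcond /= IH 1?ltnW // bits //.
case: ifP => _; last by rewrite addn0.
by rewrite exprD invfM mulrA natrX.
Qed.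

(** The [4 + q] coins that an event prescribes: block, type, two bidders, and the digits of the
    exponent. Such an event has probability at least [1 / 2 ^ (4 + q)]. *)
Definition coin_positions (i1 i2 : nat) : seq nat :=
  [:: 0; 1; (2 + i1); (2 + i2)]%N ++ iota (2 + n) q.

Definition coin_target (upper c : bool) (g : nat -> bool) (t p : nat) : bool :=
  if p == 0%N then upper else if p == 1%N then c else
  if (p < 2 + n)%N then g (p - 2)%N else digit 2 t (p - (2 + n)) == 1%N.

Lemma matches_coins upper c g t (i1 i2 : 'I_n) w :
  matches (coin_target upper c g t) (coin_positions i1 i2) w ->
  [/\ w 0%N = upper, w 1%N = c, w (2 + i1)%N = g i1, w (2 + i2)%N = g i2 &
    forall j, (j < q)%N -> w (2 + n + j)%N = (digit 2 t j == 1%N)].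
Proof.
have target_g (i : 'I_n) : coin_target upper c g t (2 + i) = g i.
  by rewrite /coin_target /= ltn_add2l ltn_ord addKn.
rewrite /matches /coin_positions all_cat /= => /andP[/and5P[/eqP w0 /eqP w1 w_1 w_2 _] /allP w_t].
split=> //; [by rewrite -target_g; apply/eqP | by rewrite -target_g; apply/eqP |].
move=> j lt_j; have in_t : (2 + n + j)%N \in iota (2 + n) q by rewrite mem_iota leq_addr ltn_add2l.
by rewrite (eqP (w_t _ in_t)) /coin_target /= ltnNge leq_addr /= addKn.
Qed.

Let T := (40 * 100 * (n + (m * (max_outdeg M + 1)) ^ m))%N.
Local Notation E := (expect T (fun w => welfare w)).

Lemma coin_positions_ok (i1 i2 : 'I_n) :
  all (fun p => p < T)%N (coin_positions i1 i2) /\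
  size (coin_positions i1 i2) = (4 + q)%N.
Proof.
have le_T : (2 + n + q <= T)%N.
  apply: leq_trans (run_time_le M v (fun=> false)); rewrite /run_time.
  by move: (_ ^ _ * _)%N => u; lia.
split; last by rewrite size_cat size_iota.
move: (T) le_T => T' le_T.
rewrite /coin_positions all_cat; apply/andP; split.
  by have := ltn_ord i1; have := ltn_ord i2; rewrite /= => lt_1 lt_2; apply/and5P; split=> //; lia.
by apply/allP => p; rewrite mem_iota; lia.
Qed.

Lemma price_ge0 w : 0 <= price M v w.
Proof.
rewrite /price; elim: (q) => [|k IH] /=; first exact: sample_max_ge0.
by case: ifP => // _; rewrite divr_ge0.
Qed.

Lemma welfare_ge0 w : 0 <= welfare w.
Proof.
rewrite mechanism_welfare //; apply: sumr_ge0 => i _.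
by rewrite mulr_ge0 // click_rate_ge0.
Qed.

(** * Bidders of one self-loop status *)

Section OneType.
Variables (W : {set 'I_n}) (slot : 'I_n -> 'I_m) (c : bool) (i1 : 'I_n).
Hypothesis slot_inj : {in W &, injective slot}.
Hypothesis W_ok :
  {in W &, forall i j, ~~ (conflict M i j && slot_conflict M (slot i) (slot j))}.
Hypothesis type_i1 : conflict M i1 i1 = c.
Hypothesis max_i1 : forall i, conflict M i i = c -> v i <= v i1.

Let type_okE w (i : 'I_n) : w 1%N = c -> type_ok M w i = (conflict M i i == c).
Proof. by move=> w1; rewrite /type_ok lookup2_ord w1. Qed.

Definition high (i : 'I_n) : bool :=
  [&& i \in W, conflict M i i == c, i != i1 & v i1 / 2 ^+ (2 ^ q).-1 < v i].

(** Each term is collected when [i1] is sampled, [i] is not, and the exponent [t i] and the block of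
    its slot are drawn. The probability costs [2 ^ (4 + q)], rounding the value down to the price
    another 2. *)
Lemma high_bound : \sum_(i | high i) v i * ctr M (slot i) <= 2 ^+ (5 + q) * E.
Proof.
pose t i := find (fun j => v i1 / 2 ^+ j < v i) (iota 0 (2 ^ q)).
have q2_gt0 : (0 < 2 ^ q)%N by rewrite expn_gt0.
have tP i : high i -> [/\ (t i < 2 ^ q)%N, v i1 / 2 ^+ t i < v i & v i <= 2 * (v i1 / 2 ^+ t i)].
  case/and4P => _ /eqP type_i _ high_i.
  have has_t : has (fun j => v i1 / 2 ^+ j < v i) (iota 0 (2 ^ q)).
    by apply/hasP; exists (2 ^ q).-1 => //; rewrite mem_iota add0n ltn_predL.
  have lt_t : (t i < 2 ^ q)%N by move: has_t; rewrite has_find size_iota.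
  have := nth_find 0%N has_t; rewrite -/(t i) nth_iota // add0n => above.
  (* No value of this type exceeds that of [i1], so [t i] is positive, and its predecessor failing
     the test gives the factor 2. *)
  split=> //; case def_t: (t i) above => [|j] above.
    by move: above; rewrite expr0 divr1 ltNge max_i1.
  have := @before_find _ 0%N (fun j => v i1 / 2 ^+ j < v i) (iota 0 (2 ^ q)) j.
  rewrite -/(t i) def_t nth_iota ?add0n => [/(_ (ltnSn j))/negbT|]; last by lia.
  rewrite -leNgt; suff -> : 2 * (v i1 / 2 ^+ j.+1) = v i1 / 2 ^+ j by [].
  by rewrite exprS invfM mulrCA mulVKf ?pnatr_eq0.
pose f i := coin_target (h <= slot i)%N c (fun j => j == i1) (t i).
suff /ler_wpM2l : \sum_(i | high i) v i * ctr M (slot i) / 2 <= 2 ^+ (4 + q) * E.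
  by move/(_ 2 (ler0n _ _)); rewrite mulrA -exprS -mulr_suml mulrC divfK ?pnatr_eq0.
apply: (expect_ge_sum (f := f) (ps := fun i => coin_positions i1 i)).
- by move=> i _; rewrite divr_ge0 // mulr_ge0 // ctr_ge0.
- by move=> i _; apply: coin_positions_ok.
(* The bidders whose events occur at [w] all face the same price and are eligible together, so one
   search pays for all of them. *)
move=> w; pose W' := [set i | high i && matches (f i) (coin_positions i1 i) w].
have W'P i : i \in W' -> [/\ high i, price M v w = v i1 / 2 ^+ t i,
    w 0%N = (h <= slot i)%N & eligible M v w i].
  rewrite inE => /andP[high_i /matches_coins[w0 w1 w_i1 w_i w_t]].
  have [lt_t above _] := tP i high_i.
  have /and4P[_ type_i neq_i _] := high_i.
  have def_max : sample_max M v w n = v i1.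
    apply/le_anti/andP; split; last first.
      by apply: sample_max_ge; rewrite ?w_i1 /= ?eqxx // type_okE // type_i1.
    by apply: sample_max_le => // j _; rewrite type_okE // => /eqP; apply: max_i1.
  have def_p : price M v w = v i1 / 2 ^+ t i by rewrite (price_bits lt_t) // def_max.
  split=> //; rewrite /eligible w_i def_p lookup_ord above type_okE // type_i andbT /=.
  by rewrite andbT.
have sW' i : i \in W' -> i \in W by move/W'P => [/and4P[]].
have le_w := @mechanism_welfare_ge w (price M v w) W' slot (price_ge0 w).
apply: le_trans (le_w _ _ _ _ _).
- rewrite mulr_sumr (eq_bigl (fun i => i \in W')) => [|i]; last by rewrite inE.
  apply: ler_sum => i W'i; have [high_i -> _ _] := W'P i W'i; have [_ _ le_v] := tP i high_i.
  by rewrite mulrAC ler_wpM2r ?ctr_ge0 // ler_pdivrMr // mulrC.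
- by move=> i /and3P[_]; rewrite lookup_ord => /ltW.
- by move=> i /W'P[].
- by move=> i j /sW' Wi /sW' Wj; apply: slot_inj.
- by move=> i /W'P[].
- by move=> i j /sW' Wi /sW' Wj; apply: W_ok.
Qed.

(** Bidder [i1] stays out of the sample and the best rival [i2] is in it. Without a tie the price is
    the second value and only [i1] is eligible; with a tie it is halved, and every eligible value
    exceeds half of the top one. The search then secures at least the rate of [k]. *)
Lemma solo_bound (k : 'I_m) : (0 < q)%N -> ~~ (c && slot_conflict M k k) ->
  v i1 * ctr M k <= 2 ^+ (5 + q) * E.
Proof.
move=> q_gt0 k_ok.
pose other := [pred j | (j != i1) && (conflict M j j == c)].
(* Without a rival [i2] falls back to [i1], which makes [tie] false. *)
pose i2 := [arg max_(j > odflt i1 [pick j | other j] | other j) v j]%O.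
have i2P : (forall j, ~~ other j) \/ (other i2 /\ forall j, other j -> v j <= v i2).
  rewrite /i2; case: pickP => [j other_j|none] /=; last by left=> j; apply/negbT/none.
  by right; case: arg_maxP.
pose tie := other i2 && (v i2 == v i1).
have tie_lt : (tie < 2 ^ q)%N.
  by apply: leq_ltn_trans (leq_b1 _) _; rewrite -{1}(expn0 2) ltn_exp2l.
pose f := coin_target (h <= k)%N c (fun j => j != i1) tie.
suff le_half : v i1 * ctr M k / 2 <= 2 ^+ (4 + q) * E.
  by move/(ler_wpM2l (ler0n R 2)): le_half; rewrite [2 * (2 ^+ _ * _)]mulrA -exprS mulrC divfK ?pnatr_eq0.
rewrite -[leLHS](big_pred1_eq +%R tt (fun=> v i1 * ctr M k / 2)).
apply: (expect_ge_sum (f := fun=> f) (ps := fun=> coin_positions i1 i2)).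
- by move=> _ _; rewrite divr_ge0 // mulr_ge0 // ctr_ge0.
- by move=> _ _; apply: coin_positions_ok.
move=> w; have [match_w|nmatch] := boolP (matches f (coin_positions i1 i2) w); last first.
  by rewrite big_pred0 ?welfare_ge0 // => i; rewrite andbF.
rewrite (eq_bigl (pred1 tt)) ?big_pred1_eq => [|i]; last by rewrite andbT.
have [w0 w1 w_i1 w_i2 w_t] := matches_coins match_w.
rewrite eqxx in w_i1.
(* Eligibility is strict, so a top value of 0 is treated apart. *)
have [v0|v_gt0] := eqVneq (v i1) 0; first by rewrite v0 !mul0r welfare_ge0.
have {}v_gt0 : 0 < v i1 by rewrite lt_neqAle eq_sym v_gt0 v_ge0.
have solo (u : R) : v i1 / 2 <= u -> (forall i : 'I_n, eligible M v w i -> u <= v i) ->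
    price M v w < v i1 -> v i1 * ctr M k / 2 <= welfare w.
  move=> le_u u_le lt_p; rewrite mulrAC.
  have u_ge0 : 0 <= u by apply: le_trans le_u; rewrite divr_ge0.
  have := @mechanism_welfare_ge w u [set i1] (fun=> k) u_ge0 u_le.
  rewrite big_set1 => /(_ _ _ _ _)/(le_trans (ler_wpM2r (ctr_ge0 M k) le_u)); apply.
  - move=> i /set1P->; rewrite /eligible w_i1 lookup_ord lt_p type_okE // type_i1 eqxx.
    by [].
  - by move=> i j /set1P-> /set1P->.
  - by [].
  - by move=> i j /set1P-> /set1P->; rewrite type_i1.
have def_p : price M v w = sample_max M v w n / 2 ^+ tie by rewrite (price_bits tie_lt).
have lt_max : tie = false -> sample_max M v w n < v i1.
  move=> no_tie; case: i2P => [none|[other_i2 max_i2]].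
    apply: le_lt_trans v_gt0; apply: sample_max_le => // j w_j.
    rewrite type_okE // => type_j; have := none j; rewrite /= type_j andbT negbK => /eqP eq_j.
    by rewrite eq_j w_i1 in w_j.
  apply: (@le_lt_trans _ _ (v i2)).
    apply: sample_max_le => // j w_j; rewrite type_okE // => type_j; apply: max_i2.
    by rewrite /= type_j andbT; apply: contraTneq w_j => ->; rewrite w_i1.
  rewrite lt_neqAle; move: no_tie; rewrite /tie other_i2 /= => ->.
  by have /andP[_ /eqP] := other_i2; apply: max_i1.
case: (boolP tie) => [is_tie|/negbTE no_tie].
  have def_max : sample_max M v w n = v i1.
    have /andP[/andP[neq_i2 type_i2] /eqP eq_v] := is_tie.
    apply/le_anti/andP; split; last first.
      by rewrite -eq_v; apply: sample_max_ge; rewrite ?w_i2 ?type_okE.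
    by apply: sample_max_le => // j _; rewrite type_okE // => /eqP; apply: max_i1.
  rewrite is_tie def_max expr1 in def_p.
  apply: (solo (v i1 / 2)) => // [i /and3P[_]|]; first by rewrite def_p lookup_ord => /ltW.
  by rewrite def_p ltr_pdivrMr // ltr_pMr // ltr1n.
rewrite no_tie expr0 divr1 in def_p; have {}lt_max := lt_max no_tie.
apply: (solo (v i1)); rewrite ?def_p //; first by rewrite ler_pdivrMr // ler_peMr // ler1n.
(* An eligible rival would exceed the price, which is at least the value of the sampled [i2]. *)
move=> i /and3P[w_i lt_i type_i]; rewrite type_okE // in type_i.
have [->//|neq_i] := eqVneq i i1.
have other_i : other i by rewrite /= neq_i.
case: i2P => [/(_ i)|[other_i2 max_i2]]; first by rewrite other_i.
have : v i2 <= sample_max M v w n.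
  have /andP[neq_i2 type_i2] := other_i2.
  by apply: sample_max_ge; rewrite ?w_i2 ?type_okE.
move/le_lt_trans; rewrite -def_p lookup_ord in lt_i * => /(_ _ lt_i).
by rewrite ltNge max_i2.
Qed.

End OneType.

End Approximation.

(** * The logarithmic ratio *)

Section Ratio.
Variables (R : realType) (n m : nat) (M : market R n m).
Hypothesis m_gt2 : (2 < m)%N.

Local Notation h := (uphalf m).
Local Notation q := (threshold_coins m).
Local Notation T := (40 * 100 * (n + (m * (max_outdeg M + 1)) ^ m))%N.

Lemma threshold_coins_gt0 : (0 < q)%N.
Proof. by rewrite -threshold_coinsP //= expn0 expn1; lia. Qed.

Lemma leq_slots_threshold : (m <= 2 ^ (2 ^ q))%N.
Proof.
rewrite /threshold_coins; case: ex_minnP => q' le_q _; apply: leq_trans le_q; lia.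
Qed.

(** By minimality one coin less does not suffice: [2 ^ (2 ^ (q - 1)) < 2 h <= m ^ 2]. Taking
    logarithms gives the bound. *)
Lemma threshold_count_le : 2 ^+ q <= 4 / ln 2 * ln m%:R :> R.
Proof.
have ln2_gt0 : 0 < ln (2 : R) by rewrite ln_gt0 // ltr1n.
have := threshold_coins_gt0; case def_q: q => [//|k] _.
have lt_k : (2 ^ (2 ^ k) < m ^ 2)%N.
  apply: (@leq_trans h.*2); first by rewrite threshold_coinsP def_q ?leqnSn.
  by rewrite expnS expn1; nia.
rewrite mulrAC ler_pdivlMr // exprS -mulrA.
suff : 2 ^+ k * ln 2 <= 2 * ln m%:R :> R.
  by move/(ler_wpM2l (ler0n R 2)); rewrite [2 * (2 * _)]mulrA -natrM.
rewrite -natrX mulr_natl -lnXn // mulr_natl -lnXn ?ltr0n; last by lia.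
rewrite ler_ln ?posrE ?exprn_gt0 ?ltr0n //; last by lia.
by rewrite -!natrX ler_nat ltnW.
Qed.

Section OneProfile.
Variable v : 'I_n -> R.
Hypothesis v_ge0 : nonneg_profile v.
Local Notation E := (expect T (fun w => social_welfare M v (mechanism M w v).1)).

(** In units of [2 ^ (5 + q) * E], the high bidders cost 1, bidder [i1] costs 1 and the remaining
    low ones 2; hence the exponent 7. *)
Lemma type_bound (W : {set 'I_n}) (slot : 'I_n -> 'I_m) (c : bool) :
  {in W &, injective slot} ->
  {in W &, forall i j, ~~ (conflict M i j && slot_conflict M (slot i) (slot j))} ->
  \sum_(i in W | conflict M i i == c) v i * ctr M (slot i) <= 2 ^+ (7 + q) * E.
Proof.
move=> slot_inj W_ok.
have E_ge0 : 0 <= E by apply: expect_ge0 => w; apply: welfare_ge0.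
case: (pickP [pred i in W | conflict M i i == c]) => [j Wj|none]; last first.
  by rewrite big_pred0 // mulr_ge0 // exprn_ge0.
case: (arg_maxP (P := [pred i in W | conflict M i i == c])
  (fun i => ctr M (slot i)) Wj) => i0 /andP[Wi0 type_i0] max_i0.
have /andP[_ type_j] := Wj.
case: (arg_maxP (P := [pred i | conflict M i i == c]) v type_j) => i1 /= /eqP type_i1 max_i1.
set A := ctr M (slot i0); set V := v i1.
have max_v i : conflict M i i = c -> v i <= V by move=> type_i; apply: max_i1; apply/eqP.
have A_ge0 : 0 <= A by apply: ctr_ge0.
have V_ge0 : 0 <= V by apply: v_ge0.
have VA : V * A <= 2 ^+ (5 + q) * E.
  apply: (solo_bound v_ge0 type_i1 max_v) => //; first exact: threshold_coins_gt0.
  (* The best slot can be handed from [i0] to [i1], since both have the same self-loop status. *)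
  by have := W_ok i0 i0 Wi0 Wi0; rewrite (eqP type_i0).
have high_le := high_bound v_ge0 slot_inj W_ok type_i1 max_v.
set low := V / 2 ^+ (2 ^ q).-1.
have low_ge0 : 0 <= low by rewrite divr_ge0 // exprn_ge0.
pose G i := (if high M v W c i1 i then v i * ctr M (slot i) else 0) +
  (if i == i1 then V * A else 0) + low * A.
apply: (@le_trans _ _ (\sum_(i in W | conflict M i i == c) G i)).
  apply: ler_sum => i Wi; rewrite /G.
  have le_A : ctr M (slot i) <= A by apply: max_i0.
  have lowA : 0 <= low * A by rewrite mulr_ge0.
  have [eq_i|neq_i] := eqVneq i i1.
    have le_VA : v i * ctr M (slot i) <= V * A by rewrite eq_i ler_wpM2l // -eq_i.
    by rewrite /high eq_i eqxx !andbF add0r ler_wpDr // -eq_i.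
  rewrite addr0 /high neq_i; have /andP[-> ->] := Wi; rewrite /=.
  case: ltP => [_|le_low]; first by rewrite ler_wpDr.
  by rewrite add0r ler_pM // ctr_ge0.
rewrite !big_split /=.
have -> : \sum_(i in W | conflict M i i == c)
    (if high M v W c i1 i then v i * ctr M (slot i) else 0) =
  \sum_(i | high M v W c i1 i) v i * ctr M (slot i).
  rewrite -big_mkcondr; apply: eq_bigl => i; rewrite /high.
  by case: (i \in W); case: (_ == c).
have le_V : \sum_(i in W | conflict M i i == c) (if i == i1 then V * A else 0) <= V * A.
  apply: (@le_trans _ _ (\sum_i if i == i1 then V * A else 0)).
    rewrite big_mkcond; apply: ler_sum => i _.
    by case: ifP => // _; case: ifP => // _; rewrite mulr_ge0.
  by rewrite -big_mkcond big_pred1_eq.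
(* Injectivity of [slot] leaves at most [m] bidders, each worth at most [2 V A / 2 ^ (2 ^ q)], and
   [m <= 2 ^ (2 ^ q)]. *)
have le_low : \sum_(i in W | conflict M i i == c) low * A <= 2 * (V * A).
  rewrite sumr_const -[_ *+ #|_|]mulr_natl !mulrA ler_wpM2r // /low.
  have le_m : (#|[pred i in W | conflict M i i == c]| <= m)%N.
    apply: (@leq_trans #|W|); first by apply/subset_leq_card/subsetP => i /andP[].
    by rewrite -(card_in_imset slot_inj) -[leqRHS]card_ord max_card.
  rewrite mulrAC ler_wpM2r // ler_pdivrMr ?exprn_gt0 //.
  rewrite -exprS prednK ?expn_gt0 // -natrX ler_nat.
  exact: leq_trans le_m leq_slots_threshold.
have -> : 2 ^+ (7 + q) * E = 4 * (2 ^+ (5 + q) * E).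
  by rewrite mulrA -[4]/((2 * 2)%:R) natrM -expr2 -exprD.
lra.
Qed.

End OneProfile.

(** The two self-loop statuses give [2 * 2 ^ 7 = 2 ^ 8], and [2 ^ q <= 4 / ln 2 * ln m] contributes
    the remaining factor. *)
Lemma mechanism_approximates :
  approximates M T (mechanism M) (2 ^+ 10 / ln 2 * ln m%:R).
Proof.
have ln2_gt0 : 0 < ln (2 : R) by rewrite ln_gt0 // ltr1n.
have lnm_gt0 : 0 < ln (m%:R : R) by rewrite ln_gt0 // ltr1n; lia.
have rho_gt0 : 0 < 2 ^+ 10 / ln 2 * ln m%:R :> R.
  by rewrite mulr_gt0 // divr_gt0 // exprn_gt0.
split=> // v v_ge0; rewrite ler_pdivrMr // mulrC.
set E := expect _ _.
have E_ge0 : 0 <= E by apply: expect_ge0 => w; apply: welfare_ge0.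
apply: bigmax_le => [|S allocS]; first by rewrite mulr_ge0 // ltW.
have m_gt0 : (0 < m)%N by lia.
have [W [slot [slot_inj W_ok le_S]]] := allocation_matching M v_ge0 (Ordinal m_gt0) allocS.
apply: le_trans le_S _.
rewrite (bigID (fun i => conflict M i i == true)) /=.
have le_t := type_bound v_ge0 true slot_inj W_ok.
have le_f := type_bound v_ge0 false slot_inj W_ok.
apply: (@le_trans _ _ (2 ^+ 8 * (2 ^+ q * E))).
  have -> : 2 ^+ 8 * (2 ^+ q * E) = 2 ^+ (7 + q) * E + 2 ^+ (7 + q) * E.
    by rewrite exprD; move: (2 ^+ q) => y; ring.
  rewrite lerD //; apply: le_trans le_f; rewrite le_eqVlt; apply/predU1P; left.
  by apply: eq_bigl => i; case: (conflict M i i).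
apply: le_trans (ler_wpM2l _ (ler_wpM2r E_ge0 threshold_count_le)) _; first exact: exprn_ge0.
by rewrite le_eqVlt; apply/predU1P; left; move: (ln 2)^-1 => y; ring.
Qed.

End Ratio.

Theorem theorem18 (R : realType) :
  exists (P : cmd) (C : R) (c m0 : nat),
  forall (n m : nat) (M : market R n m),
    let T := (c * (n + (m * (max_outdeg M + 1)) ^ m))%N in
    let F := computed_mechanism M P T in
    [/\ runs_in_time M P T,
        universally_truthful M F
      & (m0 <= m)%N -> approximates M T F (C * ln m%:R)].
Proof.
(* From [m = 3] on there is at least one exponent coin, which the tie case requires. *)
exists program, (2 ^+ 10 / ln 2), (40 * 100)%N, 3%N => n m M T F; split.
- by move=> b w _; have [] := run_program M b w.
- exact: mechanism_truthful.
- exact: mechanism_approximates.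
Qed.
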